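(* Let $\mathsf W_4=e_2\otimes e_1\otimes e_1\otimes e_1+e_1\otimes e_2\otimes e_1\otimes e_1+e_1\otimes e_1\otimes e_2\otimes e_1+e_1\otimes e_1\otimes e_1\otimes e_2\in(\mathbb C^2)^{\otimes4}$, with legs labelled $A,B,C,D$. For any probability distribution $\theta=(\theta_{AB},\theta_A,\theta_B,\theta_C,\theta_D)$, i.e. any probability distribution supported on the bipartitions $AB|CD$, $A|BCD$, $B|ACD$, $C|ABD$, $D|ABC$, one has $$E^\theta(\mathsf W_4)=E_\theta(\mathsf W_4).$$
   Context: **Bipartitions.** Here $k=4$, legs $A,B,C,D$. $V=V_1\otimes\cdots\otimes V_k$, $V_i=\mathbb C^{d_i}$ with standard inner product, $V_S=\bigotimes_{i\in S}V_i$. A bipartition of $[k]=\{1,\dots,k\}$ is an unordered pair $b=\{S,\overline S\}=S|\overline S$ with $\emptyset\ne S\subsetneq[k]$, $\overline S=[k]\setminus S$. Two bipartitions are mutually laminar if one side of the first is contained in one side of the second; the five bipartitions listed in the claim are pairwise mutually laminar. **Logarithmic lower quantum functional.** For $\psi\neq0$ let $\psi_S:V_{\overline S}^*\to V_S$ be the flattening, $\rho_S=\psi_S\psi_S^*/\|\psi\|_2^2$, $H_b(\psi)=H(\rho_S)$ the von Neumann entropy (base 2), $H_\theta=\sum_b\theta_bH_b$, $E_\theta(\psi)=\sup_{A_j\in\mathrm{GL}(V_j)}H_\theta((A_1\otimes\cdots\otimes A_k)\psi)$. **Logarithmic upper quantum functional.** For $n\ge1$ and $\lambda\vdash n$, let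 $P_\lambda^{V_S}$ be the projector on $V^{\otimes n}\cong V_S^{\otimes n}\otimes V_{\overline S}^{\otimes n}$ onto the $\lambda$-isotypic component of the symmetric group $S_n$ permuting the factors of $V_S^{\otimes n}$ (acting trivially on $V_{\overline S}^{\otimes n}$), $P_{(n)}^{V_{[k]}}$ the projector onto the symmetric subspace of $V^{\otimes n}$, and $P_\lambda^{V_b}=P_\lambda^{V_S}P_{(n)}^{V_{[k]}}$ for $b=\{S,\overline S\}$ (independent of the side; these commute for mutually laminar bipartitions). For $\theta$ with pairwise mutually laminar support, $E^\theta(\psi)=\sup\sum_{b\in\mathrm{supp}\,\theta}\theta_bH(\lambda^{(b)}/n)$ over all $n\ge1$ and tuples of partitions $\lambda^{(b)}\vdash n$ with $\big(\prod_{b\in\mathrm{supp}\,\theta}P^{V_b}_{\lambda^{(b)}}\big)\psi^{\otimes n}\ne0$, where $H$ is Shannon entropy (base 2). *)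

(* Defs.v *)
From HB Require Import structures.
From mathcomp Require Import all_boot all_order all_algebra all_fingroup.
From mathcomp Require Import complex.
From mathcomp Require Import boolp classical_sets reals ereal exp.

Set Implicit Arguments.
Unset Strict Implicit.
Unset Printing Implicit Defensive.

Import Order.TTheory GRing.Theory Num.Theory.
Local Open Scope ring_scope.

Section Bipartition.
Variable k : nat.

Definition cut (S : {set 'I_k}) : {set {set 'I_k}} := [set S; ~: S].

Definition is_bipartition (b : {set {set 'I_k}}) : bool :=
  [exists S : {set 'I_k}, [&& S != finset.set0, S != finset.setT & b == cut S]].

Definition bipartition := {b : {set {set 'I_k}} | is_bipartition b}.

(* H_b and P^{V_b} below do not depend on the side of b used to define them.
   We use the smaller side, or, when both sides have k/2 elements, the one
   containing the first leg; exactly one side of b satisfies this. *)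
Definition is_short_side (S : {set 'I_k}) : bool :=
  (#|S|.*2 < k)%N
  || (#|S|.*2 == k)%N && [exists i in S, nat_of_ord i == 0%N].

Definition side (b : bipartition) : {set 'I_k} :=
  odflt finset.set0 [pick S in val b | is_short_side S].

Definition is_distribution (R : realType) (theta : bipartition -> R) : Prop :=
  (forall b, 0 <= theta b) /\ \sum_b theta b = 1.

End Bipartition.

Section Entropy.
Variable R : realType.

Definition log2 (x : R) : R := ln x / ln 2.

(* ln 0 = 0 in the library, so that 0 log 0 = 0. *)
Definition entropy_term (p : R) : R := - (p * log2 p).

(* spectral_diag lists the eigenvalues of a normal matrix with multiplicity;
   those of a density matrix are real. *)
Definition von_neumann m (rho : 'M[R[i]]_m) : R :=
  \sum_(j < m) entropy_term (complex.Re (spectral_diag rho 0 j)).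

Definition part_entropy (n : nat) (la : seq nat) : R :=
  \sum_(l <- la) entropy_term (l%:R / n%:R).

End Entropy.

Definition is_partition (n : nat) (la : seq nat) : bool :=
  [&& sorted geq la, 0%N \notin la & sumn la == n].

Section Symmetric.
Variables (R : realType) (n : nat).
Local Notation C := R[i].

(* The group algebra C[S_n].  In the library (g * h)%g means "g, then h", so
   the composite "g after h" is (h * g)%g; left actions are taken with respect
   to composition. *)
Definition galg := {ffun 'S_n -> C^o}.

Definition gelt (g : 'S_n) : galg := [ffun h => (h == g)%:R].

Definition lreg (g : 'S_n) : 'End(galg) :=
  linfun (fun a : galg => [ffun h => a (h * g^-1)%g] : galg).

(* Rows and columns of the tableau of shape la filled with 0, .., n-1 from
   left to right, row after row. *)
Definition row_stab (la : seq nat) : {set 'S_n} :=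
  [set g : 'S_n | [forall m, reshape_index la (g m) == reshape_index la m]].
Definition col_stab (la : seq nat) : {set 'S_n} :=
  [set g : 'S_n | [forall m, reshape_offset la (g m) == reshape_offset la m]].

Definition young_symmetrizer (la : seq nat) : galg :=
  \sum_(p in row_stab la) \sum_(q in col_stab la)
    ((-1) ^+ odd_perm q : C) *: gelt (q * p)%g.

(* The irreducible S_n-module [la], as a left ideal of C[S_n]. *)
Definition specht (la : seq nat) : {vspace galg} :=
  span [seq lreg g (young_symmetrizer la) | g : 'S_n].

Variables (W : vectType C) (act : 'S_n -> 'End(W)).

Definition equivariant_homs : {vspace 'Hom(galg, W)} :=
  (\bigcap_(g : 'S_n)
     lker (linfun (fun f : 'Hom(galg, W) =>
        (f \o lreg g)%VF - (act g \o f)%VF)))%VS.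

(* The sum of the images of [la] under all equivariant maps to W; by
   semisimplicity every equivariant map [la] -> W extends to C[S_n], and by
   linearity a basis of the space of equivariant maps is enough. *)
Definition isotypic (la : seq nat) : {vspace W} :=
  (\sum_(f <- vbasis equivariant_homs) f @: specht la)%VS.

Definition invariants : {vspace W} := (\bigcap_(g : 'S_n) fixedSpace (act g))%VS.

End Symmetric.

Section Projector.
Variables (R : realType) (I : finType).
Local Notation C := R[i].
Local Notation W := {ffun I -> C^o}.

Definition inner (u v : W) : C := \sum_i u i * (v i)^*.

Definition orthocompl (U : {vspace W}) : {vspace W} :=
  (\bigcap_(u <- vbasis U) lker (linfun (fun v : W => inner v u : C^o)))%VS.

Definition orthoproj (U : {vspace W}) : 'End(W) := daddv_pi U (orthocompl U).

End Projector.

Section Tensor.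
Variables (R : realType) (k : nat) (d : 'I_k -> nat).
Local Notation C := R[i].

(* Indices of the standard bases of V and of V_S (S given by a predicate). *)
Definition idx := {dffun forall i : 'I_k, 'I_(d i)}.
Definition sidx (P : pred 'I_k) := {dffun forall i : {i | P i}, 'I_(d (val i))}.

Definition tensor := {ffun idx -> C^o}.

Definition pure (v : forall i, 'cV[C]_(d i)) : tensor :=
  [ffun x : idx => \prod_i v i (x i) 0].

Definition gl_act (A : forall i, 'M[C]_(d i)) (psi : tensor) : tensor :=
  [ffun x : idx => \sum_(y : idx) (\prod_i A i (x i) (y i)) * psi y].

Definition merge (S : {set 'I_k})
    (x : sidx (fun i => i \in S)) (y : sidx (fun i => i \notin S)) : idx :=
  [ffun i => match boolP (i \in S) with
             | AltTrue h => x (exist _ i h)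
             | AltFalse h => y (exist _ i h)
             end].

Definition flattening (S : {set 'I_k}) (psi : tensor) :
    'M[C]_(#|{: sidx (fun i => i \in S)}|, #|{: sidx (fun i => i \notin S)}|) :=
  \matrix_(a, b) psi (merge (enum_val a) (enum_val b)).

Definition density (S : {set 'I_k}) (psi : tensor) :
    'M[C]_#|{: sidx (fun i => i \in S)}| :=
  (\sum_x `|psi x| ^+ 2)^-1
    *: (flattening S psi *m map_mx Num.conj (flattening S psi)^T).

Definition H_ (b : bipartition k) (psi : tensor) : R :=
  von_neumann (density (side b) psi).

Definition log_lower (theta : bipartition k -> R) (psi : tensor) : \bar R :=
  ereal_sup [set (\sum_b theta b * H_ b (gl_act A psi))%:E
            | A in [set A : forall i, 'M[C]_(d i) | forall i, A i \in unitmx]].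

(* V^{(x) n}, with standard basis indexed by n-tuples of elements of idx. *)
Definition ptensor (n : nat) := {ffun {ffun 'I_n -> idx} -> C^o}.

Definition tpow (n : nat) (psi : tensor) : ptensor n :=
  [ffun X : {ffun 'I_n -> idx} => \prod_m psi (X m)].

Definition perm_idx n (S : {set 'I_k}) (g : 'S_n) (X : {ffun 'I_n -> idx}) :
    {ffun 'I_n -> idx} :=
  [ffun m => [ffun i => if i \in S then X (g m) i else X m i] : idx].

(* S_n permuting the tensor factors of V_S^{(x) n}: the m-th factor goes to
   position g m. *)
Definition sym_act n (S : {set 'I_k}) (g : 'S_n) : 'End(ptensor n) :=
  linfun (fun T : ptensor n => [ffun X => T (perm_idx S g X)] : ptensor n).

Definition proj_side n (S : {set 'I_k}) (la : seq nat) : 'End(ptensor n) :=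
  orthoproj (isotypic (@sym_act n S) la).

Definition proj_sym n : 'End(ptensor n) :=
  orthoproj (invariants (@sym_act n [set: 'I_k])).

Definition proj_bip n (b : bipartition k) (la : seq nat) : 'End(ptensor n) :=
  (proj_side n (side b) la \o proj_sym n)%VF.

(* Meant for theta with pairwise mutually laminar support: the factors of the
   product then commute, so that their order is irrelevant. *)
Definition proj_family n (theta : bipartition k -> R)
    (la : bipartition k -> seq nat) : 'End(ptensor n) :=
  \big[@comp_lfun _ _ _ _ / \1%VF]_(b | theta b != 0) proj_bip n b (la b).

Definition log_upper (theta : bipartition k -> R) (psi : tensor) : \bar R :=
  ereal_sup [set r : \bar R | exists n (la : bipartition k -> seq nat),
    [/\ (0 < n)%N,
        forall b, theta b != 0 -> is_partition n (la b),
        proj_family n theta la (tpow n psi) != 0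
      & r = (\sum_(b | theta b != 0) theta b * part_entropy R n (la b))%:E]].

End Tensor.

Definition legA : 'I_4 := inord 0.
Definition legB : 'I_4 := inord 1.
Definition legC : 'I_4 := inord 2.
Definition legD : 'I_4 := inord 3.

Definition e1 (R : realType) : 'cV[R[i]]_2 := delta_mx 0 0.
Definition e2 (R : realType) : 'cV[R[i]]_2 := delta_mx 1 0.

Definition W4 (R : realType) : tensor R (fun _ : 'I_4 => 2%N) :=
  \sum_(j < 4) pure (fun i : 'I_4 => if i == j then e2 R else e1 R).

(* Main.v *)
Require Import Defs.
From HB Require Import structures.
From mathcomp Require Import all_boot all_order all_algebra all_fingroup.
From mathcomp Require Import complex ring lra zify.
From mathcomp Require Import boolp classical_sets reals ereal exp.

(** Call a leg in state [e_2] excited.  Let [h] be the binary entropy, and for a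
    probability vector [p] on the four legs let [F p] be the sum over the
    bipartitions [b] of [theta b * h (p_S)], where [S] is a side of [b] and [p_S]
    is the total probability of the legs in [S].  Both functionals are equal to the
    maximum of the concave function [F] ([excitation_entropy]).

    Lower functional.  A tensor in the orbit of W has the form of [w_vector]: one
    leg is in a state [v_j] orthogonal to the state [u_j] of the other terms, plus
    a multiple of the product of the [u_j].  Its flattenings have rank two, and the
    determinant of a reduced density matrix is at most [p_S (1 - p_S)], where [p_j]
    is proportional to [|v_j|^2 / |u_j|^2]; equality holds for diagonal matrices.
    So the entropies are at most, and for suitable diagonal matrices exactly,
    [h (p_S)] ([orbit_entropy_le], [orbit_entropy_diag]).

    Upper functional, bound from above.  The projectors commute with each other
    ([proj_bip_comm]) and with the projections to fixed numbers of excitations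
    ([proj_bip_cutoff]).  If their product does not annihilate the [n]-th power of
    W, then the excitation numbers [w_j] of a word in the support of the result
    have sum [n], and each projector alone does not annihilate the component with
    [w_S] excitations on [S].  That component lives in the [n]-th power of a plane,
    so the partition has at most two rows, and its second row [m] satisfies
    [m <= w_S <= n - m] ([proj_family_neq0_weights]).  Hence [h (m / n)] is at most
    [h (w_S / n)].

    Upper functional, bound from below.  Since the projectors are self-adjoint, it
    suffices to find a vector that all of them fix and that is not orthogonal to
    the power of W ([proj_family_inner]).  For [n = 2N] and counts [w] with
    [w_j <= N] and [w_A + w_B <= N], split the positions into [N] pairs and regard
    [AB], [C], [D] as three blocks.  Put singlets on two of the three blocks at
    each pair and the vacuum on the third one, and keep the part with [w_A]
    excitations on [A].  On [AB], [C], [D] this is a product of singlets, and on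
    [A] and [B] a sum of such products, so it lies in the isotypic components with
    second rows [w_A + w_B], [w_C], [w_D], [w_A], [w_B]; all terms of its pairing
    with the power of W have the same sign ([witness_tpow_neq0]).  Other counts are
    first balanced ([balance_counts]), or [AB] and [CD] change roles, which is
    possible because both sides of a bipartition have the same isotypic components
    in the symmetric subspace ([proj_sym_isotypic_complement]).

    Concavity of [F] passes from rational points, and from points with positive
    coordinates, to all of the simplex ([excitation_entropy_mix]). *)

Set Implicit Arguments.
Unset Strict Implicit.
Unset Printing Implicit Defensive.

Import Order.TTheory GRing.Theory Num.Theory.
Local Open Scope ring_scope.

(** * Orthogonal projections *)

Section Linfun.
Variables (K : fieldType) (U V : vectType K).
Lemma linfunE (f : U -> V) : linear f -> linfun f =1 f.
Proof.
move=> lf x.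
pose g : {linear U -> V} := HB.pack f (GRing.isLinear.Build K U V *:%R f lf).
by rewrite (lfunE g).
Qed.
End Linfun.

Section OrthogonalProjection.
Variables (R : realType) (I : finType).
Local Notation C := R[i].
Local Notation W := {ffun I -> C^o}.
Implicit Types (U : {vspace W}) (u v w : W) (f g : 'End(W)).

Lemma innerE u v : inner u v = \sum_i (u i : C) * (v i : C)^* :> C.
Proof. by []. Qed.

Lemma regular_scaleE (a z : C) : a *: (z : C^o) = a * z. Proof. by []. Qed.

Lemma inner_linear v : linear (fun u : W => inner u v : C^o).
Proof.
move=> a x y; rewrite /= !innerE.
rewrite [in RHS]regular_scaleE mulr_sumr -big_split /=; apply: eq_bigr => i _.
by rewrite !ffunE mulrDl mulrA.
Qed.

Lemma innerC u v : inner u v = (inner v u)^*.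
Proof.
rewrite !innerE rmorph_sum; apply: eq_bigr => i _.
by rewrite rmorphM /= conjCK mulrC.
Qed.

Lemma innerDl u v w : inner (u + v) w = inner u w + inner v w.
Proof. by have := inner_linear w 1 u v; rewrite !scale1r. Qed.

Lemma inner0l u : inner 0 u = 0.
Proof. by rewrite /inner big1 // => i _; rewrite ffunE mul0r. Qed.

Lemma inner0r u : inner u 0 = 0.
Proof. by rewrite innerC inner0l rmorph0. Qed.

Lemma innerZl a u v : inner (a *: u) v = a * inner u v.
Proof. by have := inner_linear v a u 0; rewrite addr0 inner0l addr0. Qed.

Lemma innerNl u v : inner (- u) v = - inner u v.
Proof. by rewrite -scaleN1r innerZl mulN1r. Qed.

Lemma innerDr u v w : inner u (v + w) = inner u v + inner u w.
Proof. by rewrite innerC innerDl rmorphD /= -!innerC. Qed.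

Lemma innerZr a u v : inner u (a *: v) = a^* * inner u v.
Proof. by rewrite innerC innerZl rmorphM /= -innerC. Qed.

Lemma inner_suml (J : Type) (r : seq J) (P : pred J) (F : J -> W) v :
  inner (\sum_(j <- r | P j) F j) v = \sum_(j <- r | P j) inner (F j) v.
Proof.
elim/big_rec2: _ => [|j x y _ <-]; first exact: inner0l.
by rewrite innerDl.
Qed.

Lemma inner_sumr (J : Type) (r : seq J) (P : pred J) (F : J -> W) v :
  inner v (\sum_(j <- r | P j) F j) = \sum_(j <- r | P j) inner v (F j).
Proof.
elim/big_rec2: _ => [|j x y _ <-]; first exact: inner0r.
by rewrite innerDr.
Qed.

Lemma inner_eq0 u : (inner u u == 0) = (u == 0).
Proof.
apply/idP/eqP => [|->]; last by rewrite inner0l.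
rewrite /inner psumr_eq0 => [/allP h|i _]; last by rewrite mul_conjC_ge0.
apply/ffunP => i; rewrite ffunE; apply/eqP.
by have := h i (mem_index_enum i); rewrite mul_conjC_eq0.
Qed.

Lemma inner_ext u v : (forall w, inner u w = inner v w) -> u = v.
Proof.
move=> h; apply/eqP; rewrite -subr_eq0 -inner_eq0 innerDl innerNl h.
by rewrite subrr.
Qed.

Lemma memv_orthocompl U v :
  reflect (forall u, u \in U -> inner v u = 0) (v \in orthocompl U).
Proof.
have memE u : (v \in lker (linfun (fun w : W => inner w u : C^o))) =
    (inner v u == 0).
  by rewrite memv_ker linfunE //; apply: inner_linear.
have -> : (v \in orthocompl U) = all (fun u => inner v u == 0) (vbasis U).
  rewrite /orthocompl; elim: (tval (vbasis U)) => [|u s IH] /=.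
    by rewrite big_nil memvf.
  by rewrite big_cons memv_cap memE IH.
apply: (iffP allP) => [h u uU|h u uU]; last by rewrite h // vbasis_mem.
rewrite (coord_vbasis uU) inner_sumr big1 // => i _; rewrite innerZr.
by rewrite (eqP (h _ _)) ?mulr0 // mem_nth // size_tuple.
Qed.

Lemma capv_orthocompl U : (U :&: orthocompl U = 0)%VS.
Proof.
apply/eqP; rewrite -subv0; apply/subvP => u /memv_capP[uU /memv_orthocompl h].
by rewrite memv0 -inner_eq0 h.
Qed.

(** The orthogonal complement is the kernel of the linear map that combines the
    vectors of a basis of [U] with the inner products against them as
    coefficients; its range lies in [U], so the rank theorem gives the
    complement the missing dimension. *)
Lemma addv_orthocompl U : (U + orthocompl U = fullv)%VS.
Proof.
set n := \dim U; pose b := vbasis U.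
pose F (v : W) : W := \sum_(i < n) inner v b`_i *: b`_i.
have linF : linear F.
  move=> a x y; rewrite /F scaler_sumr -big_split; apply: eq_bigr => i _.
  by rewrite (inner_linear _ a x y) scalerDl -scalerA.
have FE := linfunE linF.
have kerF : (lker (linfun F) <= orthocompl U)%VS.
  apply/subvP => v; rewrite memv_ker FE => /eqP Fv0.
  apply/memv_orthocompl => u uU.
  have/freeP fr := basis_free (vbasisP U).
  rewrite (coord_vbasis uU) inner_sumr big1 // => i _.
  by rewrite innerZr (fr (fun i => inner v b`_i)) ?mulr0.
have imF : (limg (linfun F) <= U)%VS.
  apply/subvP => v /memv_imgP[w _ ->]; rewrite FE rpred_sum // => i _.
  by rewrite rpredZ // vbasis_mem // mem_nth // size_tuple.
apply/eqP; rewrite eqEdim subvf /=.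
rewrite dimv_disjoint_sum ?capv_orthocompl //.
have := limg_ker_dim (linfun F) fullv; rewrite capfv => <-.
by rewrite addnC leq_add // dimvS.
Qed.

Lemma orthoproj_mem U v : orthoproj U v \in U.
Proof. exact: memv_pi. Qed.

Lemma orthoproj_id U u : u \in U -> orthoproj U u = u.
Proof. by apply: daddv_pi_id; apply: capv_orthocompl. Qed.

Lemma orthoproj_compl U v : v - orthoproj U v \in orthocompl U.
Proof.
have := @daddv_pi_add _ _ U (orthocompl U) v (capv_orthocompl U).
rewrite addv_orthocompl memvf => /(_ isT) {1}<-.
by rewrite /orthoproj addrC addKr memv_pi.
Qed.

Lemma orthoproj_unique U v w :
  w \in U -> v - w \in orthocompl U -> orthoproj U v = w.
Proof.
move=> wU vw; apply/eqP; rewrite -subr_eq0 -memv0 -(capv_orthocompl U).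
rewrite memv_cap rpredB ?orthoproj_mem //=.
have -> : orthoproj U v - w = (v - w) - (v - orthoproj U v).
  by rewrite opprB [RHS]addrC subrKA.
by rewrite rpredB // orthoproj_compl.
Qed.

Lemma orthoproj_adj U u v : inner (orthoproj U u) v = inner u (orthoproj U v).
Proof.
transitivity (inner (orthoproj U u) (orthoproj U v)).
  rewrite -[in LHS](subrK (orthoproj U v) v) innerDr.
  by rewrite innerC (memv_orthocompl _ _ (orthoproj_compl U v)) ?orthoproj_mem
    // rmorph0 add0r.
rewrite -[in RHS](subrK (orthoproj U u) u) innerDl.
by rewrite (memv_orthocompl _ _ (orthoproj_compl U u)) ?orthoproj_mem // add0r.
Qed.

Definition adjoint f g := forall u v, inner (f u) v = inner u (g v).

(** An operator preserves the complement of [U] as soon as its adjoint preserves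
    [U]. *)
Lemma orthoproj_comm U f g : adjoint f g ->
    (forall u, u \in U -> f u \in U) -> (forall u, u \in U -> g u \in U) ->
  forall v, orthoproj U (f v) = f (orthoproj U v).
Proof.
move=> fg fU gU v; apply: orthoproj_unique; first exact/fU/orthoproj_mem.
rewrite -linearB; apply/memv_orthocompl => u uU.
by rewrite fg; apply: (memv_orthocompl _ _ (orthoproj_compl U v)); apply: gU.
Qed.

End OrthogonalProjection.

(** * Isotypic components of a unitary representation *)

Section Isotypic.
Variables (R : realType) (n : nat) (I : finType).
Local Notation C := R[i].
Local Notation W := {ffun I -> C^o}.
Variable act : 'S_n -> 'End(W).
Hypothesis act1 : forall x, act 1%g x = x.
Hypothesis actM : forall g h x, act (g * h)%g x = act h (act g x).
Hypothesis act_adj : forall g, adjoint (act g) (act g^-1%g).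
Variable la : seq nat.

Definition row_sym (x : W) : W := \sum_(p in row_stab n la) act p x.
Definition col_sym (x : W) : W :=
  \sum_(q in col_stab n la) ((-1) ^+ odd_perm q : C) *: act q x.

Local Notation iso := (isotypic act la).

Lemma actK g x : act g^-1%g (act g x) = x.
Proof. by rewrite -actM mulgV act1. Qed.

Lemma row_stabV p : (p^-1%g \in row_stab n la) = (p \in row_stab n la).
Proof.
rewrite !inE; apply/forallP/forallP => h m; apply/eqP.
  by have /eqP <- := h (p m); rewrite permK.
by have /eqP <- := h (p^-1%g m); rewrite permKV.
Qed.

Lemma col_stabV p : (p^-1%g \in col_stab n la) = (p \in col_stab n la).
Proof.
rewrite !inE; apply/forallP/forallP => h m; apply/eqP.
  by have /eqP <- := h (p m); rewrite permK.
by have /eqP <- := h (p^-1%g m); rewrite permKV.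
Qed.

Lemma row_sym_adj u v : inner (row_sym u) v = inner u (row_sym v).
Proof.
rewrite inner_suml inner_sumr (reindex_inj invg_inj) /=.
apply: eq_big => [p|p _]; first exact: row_stabV.
by rewrite act_adj invgK.
Qed.

Lemma col_sym_adj u v : inner (col_sym u) v = inner u (col_sym v).
Proof.
rewrite inner_suml inner_sumr (reindex_inj invg_inj) /=.
apply: eq_big => [q|q _]; first exact: col_stabV.
rewrite innerZl innerZr act_adj invgK odd_permV; congr (_ * _).
by rewrite rmorphXn rmorphN1.
Qed.

Lemma row_sym_linear : linear row_sym.
Proof.
move=> a x y; rewrite /row_sym scaler_sumr -big_split /=.
by apply: eq_bigr => p _; rewrite linearP.
Qed.

Lemma col_sym_linear : linear col_sym.
Proof.
move=> a x y; rewrite /col_sym scaler_sumr -big_split /=; apply: eq_bigr => p _.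
by rewrite linearP scalerDr !scalerA mulrC.
Qed.

(** An equivariant map out of the group algebra is determined by the image of the
    unit, which can be any vector [x]. *)
Definition orbit_hom (x : W) : 'Hom(galg R n, W) :=
  linfun (fun a : galg R n => \sum_h a h *: act h x).

Lemma orbit_homE x a : orbit_hom x a = \sum_h a h *: act h x.
Proof.
rewrite /orbit_hom linfunE // => c u v; rewrite scaler_sumr -big_split.
by apply: eq_bigr => h _; rewrite !ffunE scalerDl scalerA.
Qed.

Lemma lregE g (a : galg R n) : lreg R g a = [ffun h => a (h * g^-1)%g].
Proof.
by rewrite /lreg linfunE // => c u v; apply/ffunP => h; rewrite !ffunE.
Qed.

Lemma mem_equivariantP (f : 'Hom(galg R n, W)) :
  reflect (forall g a, f (lreg R g a) = act g (f a)) (f \in equivariant_homs act).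
Proof.
have lin g : linear (fun f : 'Hom(galg R n, W) =>
    (f \o lreg R g)%VF - (act g \o f)%VF).
  move=> c u v; apply/lfunP => a; rewrite !lfun_simp /= linearP.
  by rewrite scalerBr opprD addrACA.
apply: (iffP idP) => [|h].
  move=> fE g a.
  have : (f \in lker (linfun (fun f : 'Hom(galg R n, W) =>
      (f \o lreg R g)%VF - (act g \o f)%VF))).
    by apply: subvP fE; apply: bigcapv_inf (subvv _).
  rewrite memv_ker (linfunE (lin g)) => /eqP/lfunP/(_ a).
  by rewrite !lfun_simp /= => /eqP; rewrite subr_eq0 => /eqP.
rewrite memvE; apply/subv_bigcapP => g _; rewrite -memvE memv_ker.
rewrite (linfunE (lin g)); apply/eqP/lfunP => a.
by rewrite !lfun_simp /= h subrr.
Qed.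

Lemma orbit_hom_equivariant x : orbit_hom x \in equivariant_homs act.
Proof.
apply/mem_equivariantP => g a; rewrite !orbit_homE linear_sum /=.
rewrite (reindex_inj (mulIg g)) /=; apply: eq_bigr => h _.
by rewrite lregE ffunE mulgK linearZ /= actM.
Qed.

Lemma young_symmetrizerE (f : 'Hom(galg R n, W)) :
  f \in equivariant_homs act ->
  f (young_symmetrizer R n la) = row_sym (col_sym (f (gelt R 1%g))).
Proof.
move/mem_equivariantP => fE; rewrite /young_symmetrizer /row_sym linear_sum.
apply: eq_bigr => p _; rewrite !linear_sum; apply: eq_bigr => q _.
rewrite !linearZ /=; congr (_ *: _); rewrite -actM -fE; congr (f _).
rewrite lregE; apply/ffunP => h; rewrite !ffunE; congr (_%:R).
by rewrite (can2_eq (mulgKV _) (mulgK _)) mul1g.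
Qed.

Lemma mem_isotypic h x : act h (row_sym (col_sym x)) \in iso.
Proof.
have fE := orbit_hom_equivariant x; set f := orbit_hom x in fE.
have f1 : f (gelt R 1%g) = x.
  rewrite orbit_homE (bigD1 1%g) //= ffunE eqxx scale1r act1 big1 ?addr0 //.
  by move=> g g1; rewrite ffunE (negPf g1) scale0r.
rewrite -{1}f1 -young_symmetrizerE // -(mem_equivariantP _ fE).
have yS : lreg R h (young_symmetrizer R n la) \in specht R n la.
  by apply: memv_span; apply: map_f; rewrite mem_enum.
rewrite (coord_vbasis fE) sum_lfunE; apply: rpred_sum => i _.
rewrite scale_lfunE rpredZ // /isotypic.
have bi : (vbasis (equivariant_homs act))`_i \in
    (vbasis (equivariant_homs act) : seq _) by rewrite mem_nth // size_tuple.
rewrite (big_rem _ bi) /=; apply: subvP (addvSl _ _) _ _.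
by apply: memv_img.
Qed.

(** Let [a] be the row symmetrizer and [b] the column antisymmetrizer.  An
    equivariant map sends the Young symmetrizer to [a b] applied to the image of
    the unit, so the translates of the vectors [a b x] span the isotypic space. *)
Lemma isotypic_sub (Z : {vspace W}) :
  (forall h x, act h (row_sym (col_sym x)) \in Z) -> (iso <= Z)%VS.
Proof.
move=> hZ; rewrite /isotypic.
have : {subset (vbasis (equivariant_homs act) : seq _) <= equivariant_homs act}.
  by move=> f; apply: vbasis_mem.
elim: (tval _) => [|f s IH] fE; first by rewrite big_nil sub0v.
rewrite big_cons subv_add IH ?andbT; last first.
  by move=> f' f's; apply: fE; rewrite inE f's orbT.
have {}fE : f \in equivariant_homs act by apply: fE; rewrite inE eqxx.
rewrite /specht limg_span; apply/span_subvP => _ /mapP[_ /mapP[g _ ->] ->].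
by rewrite (mem_equivariantP _ fE) young_symmetrizerE.
Qed.

(** Here [f] sends [h a b x] to [h k a b (k^-1 f x)], which again has the shape of
    the spanning vectors. *)
Lemma isotypic_conj_stable (f : 'End(W)) (k : 'S_n) :
    (forall g x, f (act g x) = act (g ^ k)%g (f x)) ->
  forall u, u \in iso -> f u \in iso.
Proof.
move=> fE u; suff : (iso <= f @^-1: iso)%VS by move/subvP => h /h; rewrite memv_preim.
apply: isotypic_sub => h x; rewrite -memv_preim.
have fE' g y : f (act g y) = act k (act g (act k^-1%g (f y))).
  by rewrite fE conjgE -!actM mulgA.
suff -> : f (act h (row_sym (col_sym x))) =
    act (h * k)%g (row_sym (col_sym (act k^-1%g (f x)))) by apply: mem_isotypic.
rewrite fE' actM; congr (act k (act h _)).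
rewrite /row_sym !linear_sum; apply: eq_bigr => p _.
rewrite /= fE' actK; congr (act p _).
rewrite /col_sym !linear_sum; apply: eq_bigr => q _.
by rewrite !linearZ /= fE' actK.
Qed.

Lemma isotypic_stable g u : u \in iso -> act g u \in iso.
Proof. by apply: (@isotypic_conj_stable _ g) => h x; rewrite -!actM -conjgC. Qed.

Lemma col_row_sym_orthocompl t : t \in orthocompl iso -> col_sym (row_sym t) = 0.
Proof.
move/memv_orthocompl => h; apply/inner_ext => w; rewrite inner0l.
by rewrite col_sym_adj row_sym_adj h // -[row_sym _]act1 mem_isotypic.
Qed.

Lemma row_sym_stable u : u \in iso -> row_sym u \in iso.
Proof. by move=> uU; apply: rpred_sum => p _; apply: isotypic_stable. Qed.

Lemma col_sym_stable u : u \in iso -> col_sym u \in iso.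
Proof.
by move=> uU; apply: rpred_sum => p _; rewrite rpredZ // isotypic_stable.
Qed.

(** The space contains the range of the opposite product [b a] as well: a vector
    [t] orthogonal to the space satisfies [b a t = 0], because [b a] is adjoint
    to [a b]; applying [b a] to [x] thus only sees the component of [x] in the
    space, and the space is stable under the group. *)
Lemma col_row_sym_mem x : col_sym (row_sym x) \in iso.
Proof.
have -> : x = 1 *: (x - orthoproj iso x) + orthoproj iso x.
  by rewrite scale1r subrK.
rewrite row_sym_linear col_sym_linear.
rewrite col_row_sym_orthocompl ?orthoproj_compl // scaler0 add0r.
by rewrite col_sym_stable ?row_sym_stable ?orthoproj_mem.
Qed.

Lemma col_stabM q q' : q \in col_stab n la ->
  (q * q' \in col_stab n la)%g = (q' \in col_stab n la).
Proof.
rewrite !inE => /forallP h; apply/forallP/forallP => h' m.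
  have := h' (q^-1%g m); rewrite permM permKV => /eqP ->.
  by rewrite -(eqP (h (q^-1%g m))) permKV.
by rewrite permM (eqP (h' _)); apply: h.
Qed.

Lemma col_sym_anti q x : q \in col_stab n la ->
  act q (col_sym x) = ((-1) ^+ odd_perm q : C) *: col_sym x.
Proof.
move=> qC; rewrite /col_sym linear_sum scaler_sumr /=.
rewrite (reindex_inj (mulIg q^-1)%g) /=.
have qV : q^-1%g \in col_stab n la by rewrite col_stabV.
apply: eq_big => [r|r _].
  by rewrite -col_stabV invMg invgK col_stabM // col_stabV.
rewrite linearZ /= -actM mulgKV scalerA odd_permM odd_permV signr_addb.
by rewrite mulrC.
Qed.

(** A vector with nonzero projection is not orthogonal to all [h a b x]; moving
    [h a b] to the other side of the inner product turns it into [b a h^-1]. *)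
Lemma orthoproj_isotypic_neq0 v :
  orthoproj iso v != 0 -> exists h, col_sym (row_sym (act h v)) != 0.
Proof.
move=> nz; apply/existsP; apply: contraR nz => /existsPn h0.
apply/eqP/orthoproj_unique; first exact: mem0v.
rewrite subr0; apply/memv_orthocompl => u uU; apply/eqP; rewrite innerC.
suff : (iso <= orthocompl <[v]>)%VS.
  by move/subvP/(_ u uU)/memv_orthocompl => ->; rewrite ?memv_line ?rmorph0.
apply: isotypic_sub => h x; apply/memv_orthocompl => _ /vlineP[c ->].
have := h0 h^-1%g.
rewrite innerZr act_adj row_sym_adj col_sym_adj.
by move/negPn/eqP ->; rewrite inner0r mulr0.
Qed.

End Isotypic.

Section OppositeActions.
Variables (R : realType) (n : nat) (I : finType).
Local Notation C := R[i].
Local Notation W := {ffun I -> C^o}.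
Variables (act act' : 'S_n -> 'End(W)) (s : 'End(W)) (la : seq nat).
Hypothesis act1 : forall x, act' 1%g x = x.
Hypothesis actM : forall g h x, act (g * h)%g x = act h (act g x).
Hypothesis actM' : forall g h x, act' (g * h)%g x = act' h (act' g x).
Hypothesis act_adj' : forall g, adjoint (act' g) (act' g^-1%g).
Hypothesis comm : forall g h x, act g (act' h x) = act' h (act g x).
Hypothesis flip : forall g x, s (act g x) = s (act' g^-1%g x).
Hypothesis s_stable :
  forall x, x \in isotypic act' la -> s x \in isotypic act' la.

Lemma row_sym_flip z : s (row_sym act la z) = s (row_sym act' la z).
Proof.
rewrite /row_sym !linear_sum /= (reindex_inj invg_inj) /=.
apply: eq_big => [p|p _]; first exact: row_stabV.
by rewrite flip invgK.
Qed.

Lemma col_sym_flip z : s (col_sym act la z) = s (col_sym act' la z).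
Proof.
have scale_flip (c : C) q y : s (c *: act q y) = s (c *: act' q^-1%g y).
  by rewrite [LHS]linearZ [RHS]linearZ; congr (_ *: _); apply: flip.
rewrite /col_sym [in RHS](reindex_inj invg_inj) [LHS]linear_sum [RHS]linear_sum.
apply: eq_big => [q|q _]; first by rewrite col_stabV.
by rewrite odd_permV; apply: scale_flip.
Qed.

(** Inversion exchanges the products [a b] and [b a] of the symmetrizers, and
    both generate the same isotypic space. *)
Lemma isotypic_flip x : x \in isotypic act la -> s x \in isotypic act' la.
Proof.
suff : (isotypic act la <= s @^-1: isotypic act' la)%VS.
  by move/subvP => h /h; rewrite memv_preim.
apply: (isotypic_sub actM) => h y; rewrite -memv_preim.
have row_comm g z : act' g (row_sym act la z) = row_sym act la (act' g z).
  by rewrite /row_sym linear_sum; apply: eq_bigr => p _; rewrite comm.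
have col_comm g z : act' g (col_sym act la z) = col_sym act la (act' g z).
  rewrite /col_sym linear_sum; apply: eq_bigr => p _.
  by rewrite linearZ /= comm.
have row_col z :
    row_sym act' la (col_sym act la z) = col_sym act la (row_sym act' la z).
  rewrite {1}/row_sym; under eq_bigr => p _ do rewrite col_comm.
  rewrite /col_sym exchange_big /=; apply: eq_bigr => q _.
  by rewrite -scaler_sumr -linear_sum.
rewrite flip row_comm col_comm row_sym_flip row_col col_sym_flip.
exact/s_stable/col_row_sym_mem.
Qed.

End OppositeActions.

(** * Permutations of tensor factors and commuting projectors *)

Section BigComp.
Variables (K : fieldType) (V : vectType K) (J : eqType) (P : J -> 'End(V)).
Implicit Types (r : seq J) (Q : pred J).

Lemma big_comp_cons j r Q v :
  (\big[@comp_lfun _ _ _ _ / \1%VF]_(i <- j :: r | Q i) P i) v =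
  if Q j then P j ((\big[@comp_lfun _ _ _ _ / \1%VF]_(i <- r | Q i) P i) v)
  else (\big[@comp_lfun _ _ _ _ / \1%VF]_(i <- r | Q i) P i) v.
Proof. by rewrite big_cons; case: ifP => // _; rewrite comp_lfunE. Qed.

Lemma big_comp_comm (f : 'End(V)) r Q :
    (forall j, Q j -> forall v, f (P j v) = P j (f v)) ->
  forall v, f ((\big[@comp_lfun _ _ _ _ / \1%VF]_(i <- r | Q i) P i) v) =
            (\big[@comp_lfun _ _ _ _ / \1%VF]_(i <- r | Q i) P i) (f v).
Proof.
move=> fP v; elim: r => [|j r IH]; first by rewrite !big_nil !id_lfunE.
by rewrite !big_comp_cons; case: ifP => // Qj; rewrite fP // IH.
Qed.

(** If the factors commute, any of them can be applied first. *)
Lemma big_comp_eq0 j0 r Q v : j0 \in r -> Q j0 ->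
    (forall j, Q j -> forall w, P j0 (P j w) = P j (P j0 w)) ->
  P j0 v = 0 -> (\big[@comp_lfun _ _ _ _ / \1%VF]_(i <- r | Q i) P i) v = 0.
Proof.
move=> j0r Qj0 Pcomm v0; elim: r j0r => [//|j r IH].
rewrite inE big_comp_cons => /orP[/eqP <-|/IH ->].
  by rewrite Qj0 big_comp_comm // v0 linear0.
by rewrite linear0 if_same.
Qed.

Lemma comp_lfun_comm1 (f r s : 'End(V)) :
    (forall x, f (r x) = r (f x)) -> (forall x, s (r x) = r (s x)) ->
  forall x, (f \o s)%VF (r x) = r ((f \o s)%VF x).
Proof. by move=> fr sr x; rewrite !comp_lfunE sr fr. Qed.

Lemma comp_lfun_comm (f g s : 'End(V)) :
    (forall x, f (g x) = g (f x)) ->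
    (forall x, s (f x) = f (s x)) -> (forall x, s (g x) = g (s x)) ->
  forall x, (f \o s)%VF ((g \o s)%VF x) = (g \o s)%VF ((f \o s)%VF x).
Proof. by move=> fg sf sg x; rewrite !comp_lfunE sf sg fg. Qed.

End BigComp.

Section SymmetricAction.
Variables (R : realType) (k : nat) (d : 'I_k -> nat) (n : nat).
Local Notation C := R[i].
Local Notation word := {ffun 'I_n -> idx d}.
Implicit Types (S : {set 'I_k}) (g h : 'S_n) (X : word) (T : ptensor R d n).

Lemma sym_actE S g T : sym_act R d S g T = [ffun X => T (perm_idx S g X)].
Proof.
by rewrite /sym_act linfunE // => c u v; apply/ffunP => X; rewrite !ffunE.
Qed.

Lemma perm_idxM S g h X : perm_idx S g (perm_idx S h X) = perm_idx S (g * h) X.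
Proof.
apply/ffunP => m; apply/ffunP => i; rewrite !ffunE permM.
by case: (i \in S).
Qed.

Lemma perm_idx1 S X : perm_idx S 1 X = X.
Proof. by apply/ffunP => m; apply/ffunP => i; rewrite !ffunE perm1 if_same. Qed.

Lemma perm_idxK S g : cancel (perm_idx (d := d) S g) (perm_idx S g^-1).
Proof. by move=> X; rewrite perm_idxM mulVg perm_idx1. Qed.

Lemma sym_act1 S T : sym_act R d S 1 T = T.
Proof. by rewrite sym_actE; apply/ffunP => X; rewrite ffunE perm_idx1. Qed.

Lemma sym_actM S g h T : sym_act R d S (g * h) T = sym_act R d S h (sym_act R d S g T).
Proof. by rewrite !sym_actE; apply/ffunP => X; rewrite !ffunE perm_idxM. Qed.

Lemma sym_act_adj S g : adjoint (@sym_act R k d n S g) (sym_act R d S g^-1).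
Proof.
move=> u v; rewrite !innerE (reindex_inj (can_inj (perm_idxK S g^-1))) /=.
apply: eq_bigr => X _; rewrite !sym_actE !ffunE.
by rewrite -{1}(invgK g) perm_idxM mulVg perm_idx1.
Qed.

(** Permuting the larger block conjugates the permutations of the smaller one. *)
Lemma sym_act_sub S S' g h T : S \subset S' ->
  sym_act R d S' h (sym_act R d S g T) = sym_act R d S (g ^ h) (sym_act R d S' h T).
Proof.
move/fintype.subsetP => SS'; rewrite !sym_actE; apply/ffunP => X; rewrite !ffunE.
congr (T _); apply/ffunP => m; apply/ffunP => i; rewrite !ffunE.
have [iS|//] := boolP (i \in S).
by rewrite (SS' _ iS) -!permM -conjgC.
Qed.

Lemma sym_act_disjoint S S' g h T : [disjoint S & S'] ->
  sym_act R d S' h (sym_act R d S g T) = sym_act R d S g (sym_act R d S' h T).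
Proof.
move=> SS'; rewrite !sym_actE; apply/ffunP => X; rewrite !ffunE.
congr (T _); apply/ffunP => m; apply/ffunP => i; rewrite !ffunE.
have [iS|//] := boolP (i \in S).
by rewrite (disjointFr SS' iS).
Qed.

(** Laminarity in terms of one chosen side of each bipartition. *)
Definition compatible S S' :=
  [|| S \subset S', S' \subset S | [disjoint S & S']].

Definition cutoff (Q : pred word) : 'End(ptensor R d n) :=
  linfun (fun T : ptensor R d n => [ffun X => if Q X then T X else 0]
          : ptensor R d n).

Lemma cutoffE Q T X : cutoff Q T X = if Q X then T X else 0.
Proof.
rewrite /cutoff linfunE ?ffunE // => c u v.
by apply/ffunP => Y; rewrite !ffunE; case: ifP; rewrite // scaler0 addr0.
Qed.

Lemma cutoff_adj Q : adjoint (cutoff Q) (cutoff Q).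
Proof.
move=> u v; rewrite !innerE; apply: eq_bigr => X _; rewrite !cutoffE.
by case: ifP; rewrite ?rmorph0 ?mul0r ?mulr0.
Qed.

Lemma sym_act_cutoff S g Q T : (forall X, Q (perm_idx S g X) = Q X) ->
  sym_act R d S g (cutoff Q T) = cutoff Q (sym_act R d S g T).
Proof.
move=> Qinv; rewrite !sym_actE; apply/ffunP => X.
by rewrite cutoffE !ffunE cutoffE Qinv.
Qed.

Section Iso.
Variables (S : {set 'I_k}) (la : seq nat).
Let actM := @sym_actM S.
Let act1 := @sym_act1 S.
Local Notation iso := (isotypic (@sym_act R k d n S) la).

Lemma sym_act_isotypic S' h u : (S \subset S') || [disjoint S & S'] ->
  u \in iso -> sym_act R d S' h u \in iso.
Proof.
case/orP => SS'.
  apply: (isotypic_conj_stable act1 actM (k := h)) => g x.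
  exact: sym_act_sub.
apply: (isotypic_conj_stable act1 actM (k := 1%g)) => g x.
by rewrite conjg1 sym_act_disjoint.
Qed.

Lemma proj_side_act S' h T : (S \subset S') || [disjoint S & S'] ->
  proj_side R d n S la (sym_act R d S' h T) = sym_act R d S' h (proj_side R d n S la T).
Proof.
move=> SS'; apply: (orthoproj_comm (sym_act_adj S' h)) => u;
  exact: sym_act_isotypic.
Qed.

Lemma isotypic_comm (f : 'End(ptensor R d n)) :
    (forall g T, f (sym_act R d S g T) = sym_act R d S g (f T)) ->
  forall u, u \in iso -> f u \in iso.
Proof.
move=> fE; apply: (isotypic_conj_stable act1 actM (k := 1%g)) => g x.
by rewrite conjg1.
Qed.

Lemma proj_side_cutoff Q T : (forall g X, Q (perm_idx S g X) = Q X) ->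
  proj_side R d n S la (cutoff Q T) = cutoff Q (proj_side R d n S la T).
Proof.
move=> Qinv; apply: (orthoproj_comm (cutoff_adj Q)) => u;
  by apply: isotypic_comm => g x; rewrite sym_act_cutoff.
Qed.

End Iso.

Lemma memv_invariants T :
  reflect (forall g, sym_act R d [set: 'I_k] g T = T)
          (T \in invariants (@sym_act R k d n [set: 'I_k])).
Proof.
rewrite memvE; apply: (iffP subv_bigcapP) => h g.
  by have := h g isT; rewrite -memvE => /fixedSpaceP.
by move=> _; rewrite -memvE; apply/fixedSpaceP.
Qed.

(** The isotypic spaces of a block are stable under the permutations of every
    larger or disjoint block, so their projectors commute with these permutations
    and with everything built from them; in particular with the other
    projectors. *)
Lemma proj_side_comm S S' la mu T : compatible S S' ->
  proj_side R d n S la (proj_side R d n S' mu T) =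
  proj_side R d n S' mu (proj_side R d n S la T).
Proof.
wlog SS' : S S' la mu / (S \subset S') || [disjoint S & S'].
  move=> hw c; have [h|] := boolP ((S \subset S') || [disjoint S & S']).
    exact: hw.
  rewrite negb_or => /andP[n1 n2].
  have S'S : S' \subset S.
    by move: c; rewrite /compatible (negPf n1) (negPf n2) orbF.
  by symmetry; apply: hw; rewrite /compatible S'S.
move=> _; symmetry; apply: (orthoproj_comm (f := proj_side R d n S la)
  (g := proj_side R d n S la)); first exact: orthoproj_adj.
  by move=> u; apply: isotypic_comm => g x; apply: proj_side_act.
by move=> u; apply: isotypic_comm => g x; apply: proj_side_act.
Qed.

Lemma proj_sym_side S la T :
  proj_sym R d n (proj_side R d n S la T) = proj_side R d n S la (proj_sym R d n T).
Proof.
have stable u : u \in invariants (@sym_act R k d n [set: 'I_k]) ->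
    proj_side R d n S la u \in invariants (@sym_act R k d n [set: 'I_k]).
  move/memv_invariants => uI; apply/memv_invariants => g.
  by rewrite -proj_side_act ?finset.subsetT // uI.
by apply: (orthoproj_comm (f := proj_side R d n S la)
  (g := proj_side R d n S la)); first exact: orthoproj_adj.
Qed.

Lemma proj_sym_cutoff Q T :
    (forall g X, Q (perm_idx [set: 'I_k] g X) = Q X) ->
  proj_sym R d n (cutoff Q T) = cutoff Q (proj_sym R d n T).
Proof.
move=> Qinv; apply: (orthoproj_comm (cutoff_adj Q)) => u;
  by move=> /memv_invariants uI; apply/memv_invariants => g;
     rewrite sym_act_cutoff ?uI.
Qed.

Lemma tpow_invariant (psi : tensor R d) : 
  tpow n psi \in invariants (@sym_act R k d n [set: 'I_k]).
Proof.
apply/memv_invariants => g; rewrite sym_actE; apply/ffunP => X; rewrite !ffunE.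
rewrite [RHS](reindex_inj (@perm_inj _ g)) /=; apply: eq_bigr => m _.
by congr (psi _); apply/ffunP => i; rewrite !ffunE inE.
Qed.

Lemma proj_bipE (b : bipartition k) la T :
  proj_bip R d n b la T = proj_side R d n (side b) la (proj_sym R d n T).
Proof. exact: comp_lfunE. Qed.

Lemma proj_bip_invariant (b : bipartition k) la T :
  T \in invariants (@sym_act R k d n [set: 'I_k]) ->
  proj_bip R d n b la T = proj_side R d n (side b) la T.
Proof.
by move=> Tinv; rewrite proj_bipE; congr (fun_of_lfun _ _); apply: orthoproj_id.
Qed.

Lemma cutoff_invariant Q T : (forall g X, Q (perm_idx [set: 'I_k] g X) = Q X) ->
  T \in invariants (@sym_act R k d n [set: 'I_k]) ->
  cutoff Q T \in invariants (@sym_act R k d n [set: 'I_k]).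
Proof.
by move=> Qinv /memv_invariants TI; apply/memv_invariants => g;
  rewrite sym_act_cutoff ?TI.
Qed.

Lemma proj_bip_comm (b b' : bipartition k) la mu T :
    compatible (side b) (side b') ->
  proj_bip R d n b la (proj_bip R d n b' mu T) =
  proj_bip R d n b' mu (proj_bip R d n b la T).
Proof.
move=> c; apply: comp_lfun_comm; first by move=> x; apply: proj_side_comm.
  by move=> x; apply: proj_sym_side.
by move=> x; apply: proj_sym_side.
Qed.

Lemma proj_bip_cutoff (b : bipartition k) la Q T :
    (forall S g X, Q (perm_idx S g X) = Q X) ->
  proj_bip R d n b la (cutoff Q T) = cutoff Q (proj_bip R d n b la T).
Proof.
move=> Qinv; apply: comp_lfun_comm1.
  by move=> x; apply: proj_side_cutoff => g X; apply: Qinv.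
by move=> x; apply: proj_sym_cutoff => g X; apply: Qinv.
Qed.

End SymmetricAction.

(** * Binary entropy *)

Section BinaryEntropy.
Variable R : realType.
Implicit Types (x y z t a b p q : R).

Lemma ln2_gt0 : 0 < ln 2 :> R.
Proof. by rewrite ln_gt0 // ltr1n. Qed.

Lemma entropy_term0 : entropy_term 0 = 0 :> R.
Proof. by rewrite /entropy_term mul0r oppr0. Qed.

Lemma entropy_term1 : entropy_term 1 = 0 :> R.
Proof. by rewrite /entropy_term /log2 ln1 mul0r mulr0 oppr0. Qed.

Lemma entropy_term_ge0 x : 0 <= x <= 1 -> 0 <= entropy_term x.
Proof.
case/andP => x0 x1; rewrite /entropy_term /log2 oppr_ge0.
by rewrite mulr_ge0_le0 // mulr_le0_ge0 ?ln_le0 // invr_ge0 ltW // ln2_gt0.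
Qed.

(** The tangent of the concave function [- x log x] at [z]. *)
Lemma entropy_term_tangent x z : 0 <= x -> 0 < z ->
  entropy_term x * ln 2 <= - (x * ln z) - x + z.
Proof.
rewrite /entropy_term /log2 => x0 z0.
rewrite mulNr mulrA divfK ?gt_eqF ?ln2_gt0 //.
have [->|xn0] := eqVneq x 0; first by rewrite !mul0r; lra.
have {xn0}x0 : 0 < x by lra.
have zx : 0 < z / x by rewrite divr_gt0.
have : ln (z / x) <= z / x - 1.
  by have := @le_ln1Dx R (z / x - 1); rewrite [1 + _]addrC subrK; apply; lra.
rewrite ln_div ?posrE // => /(ler_wpM2l (ltW x0)).
rewrite mulrBr mulrBr mulrCA divff ?gt_eqF // !mulr1; lra.
Qed.

Lemma entropy_term_concave t x y : 0 <= t <= 1 -> 0 <= x -> 0 <= y ->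
  t * entropy_term x + (1 - t) * entropy_term y
    <= entropy_term (t * x + (1 - t) * y).
Proof.
move=> /andP[t0 t1] x0 y0; set z := t * x + _.
have tx0 : 0 <= t * x by rewrite mulr_ge0.
have ty0 : 0 <= (1 - t) * y by rewrite mulr_ge0 // subr_ge0.
have [zn0|zp] := leP z 0.
  have -> : z = 0 by rewrite /z; rewrite /z in zn0; lra.
  have vanish s u : s * u = 0 -> s * entropy_term u = 0.
    by move=> su; rewrite /entropy_term mulrN mulrA su mul0r oppr0.
  by rewrite entropy_term0 !vanish ?addr0 //; rewrite /z in zn0; lra.
rewrite -(ler_pM2r ln2_gt0) mulrDl -!mulrA.
have -> : entropy_term z * ln 2 = - (z * ln z).
  by rewrite /entropy_term /log2 mulNr mulrA divfK ?gt_eqF ?ln2_gt0.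
have h1 := ler_wpM2l t0 (entropy_term_tangent x0 zp).
have t1' : 0 <= 1 - t by lra.
have h2 := ler_wpM2l t1' (entropy_term_tangent y0 zp).
apply: le_trans (lerD h1 h2) _.
by rewrite le_eqVlt; apply/orP; left; apply/eqP; rewrite /z; ring.
Qed.

Definition bin_entropy p := entropy_term p + entropy_term (1 - p).

Lemma bin_entropyC p : bin_entropy (1 - p) = bin_entropy p.
Proof. by rewrite /bin_entropy subKr addrC. Qed.

Lemma bin_entropy_ge0 p : 0 <= p <= 1 -> 0 <= bin_entropy p.
Proof. by move=> /andP[p0 p1]; rewrite addr_ge0 // entropy_term_ge0 //; lra. Qed.

Lemma bin_entropy_concave t p q :
    0 <= t <= 1 -> 0 <= p <= 1 -> 0 <= q <= 1 ->
  t * bin_entropy p + (1 - t) * bin_entropy q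
    <= bin_entropy (t * p + (1 - t) * q).
Proof.
move=> t01 /andP[p0 p1] /andP[q0 q1]; rewrite /bin_entropy.
have -> : 1 - (t * p + (1 - t) * q) = t * (1 - p) + (1 - t) * (1 - q) by ring.
apply: le_trans (lerD (entropy_term_concave t01 p0 q0)
                      (entropy_term_concave t01 (_ : 0 <= 1 - p)
                        (_ : 0 <= 1 - q))); lra.
Qed.

(** Moving towards [1/2] increases the entropy: if [a <= b <= 1 - a], then [b]
    is a convex combination of [a] and [1 - a], where the entropy has the same
    value. *)
Lemma bin_entropy_between a b : 0 <= a -> a <= b <= 1 - a ->
  bin_entropy a <= bin_entropy b.
Proof.
move=> a0 /andP[ab b1]; have [e|ne] := eqVneq a (1 - a).
  by have -> : b = a by lra.
pose t := (1 - a - b) / (1 - a - a).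
have pos : 0 < 1 - a - a by move/eqP: ne => ne; lra.
have t01 : 0 <= t <= 1.
  by rewrite /t divr_ge0 ?ler_pdivrMr //; lra.
have tE : t * (1 - a - a) = 1 - a - b by rewrite divfK // gt_eqF.
have -> : b = t * a + (1 - t) * (1 - a) by lra.
apply: le_trans (bin_entropy_concave t01 _ _); try lra.
by rewrite bin_entropyC -mulrDl addrC subrK mul1r.
Qed.

(** For a density matrix of rank at most two with eigenvalues [a] and [1 - a], the
    product [a (1 - a)] is its determinant on the range: entropies can be compared
    through determinants. *)
Lemma bin_entropy_mono a b : 0 <= a <= 1 -> 0 <= b <= 1 ->
  a * (1 - a) <= b * (1 - b) -> bin_entropy a <= bin_entropy b.
Proof.
wlog a2 : a / a <= 1 / 2.
  move=> hw a01 b01 ab; have [|a2] := leP a (1 / 2); first by move/hw; apply.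
  by rewrite -bin_entropyC hw //; lra.
wlog b2 : b / b <= 1 / 2.
  move=> hw a01 b01 ab; have [|b2] := leP b (1 / 2); first by move/hw; apply.
  by rewrite -[leRHS]bin_entropyC hw //; lra.
move=> /andP[a0 _] /andP[b0 _] ab; apply: bin_entropy_between => //.
have [->|bn] := eqVneq b (1 / 2); first lra.
suff : a <= b by lra.
by rewrite leNgt; apply/negP => ba; nra.
Qed.

End BinaryEntropy.

(** A zero second row is dropped, because partitions have no zero entries. *)
Definition two_rows (n m : nat) : seq nat :=
  if m == 0%N then [:: n] else [:: (n - m)%N; m].

Lemma part_entropy_two_rows (R : realType) n m : (0 < n)%N -> (m <= n)%N ->
  part_entropy R n (two_rows n m) = bin_entropy (m%:R / n%:R).
Proof.
move=> n0 mn; rewrite /part_entropy /two_rows /bin_entropy.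
have nn : n%:R != 0 :> R by rewrite pnatr_eq0 -lt0n.
have [->|_] := eqVneq m 0%N.
  by rewrite big_seq1 divff // mul0r subr0 entropy_term1 entropy_term0 addr0.
by rewrite big_cons big_seq1 natrB // mulrBl divff // addrC.
Qed.

(** * Local spectra on the orbit of W4 *)

Section Spectrum.

(** Sylvester's identity, from two block triangularisations of the same
    matrix. *)
Lemma char_poly_mulC (F : comNzRingType) m n (A : 'M[F]_(m, n)) B :
  char_poly (A *m B) * 'X^n = 'X^m * char_poly (B *m A).
Proof.
pose A' := map_mx polyC A; pose B' := map_mx polyC B.
pose N : 'M[{poly F}]_(m + n) := block_mx 'X%:M A' B' 1%:M.
have E1 : N *m block_mx 1%:M 0 (- B') 1%:M =
    block_mx ('X%:M - A' *m B') A' 0 1%:M.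
  rewrite mulmx_block !mulmx0 !mulmx1 !mul1mx mulmxN.
  by rewrite addrN !add0r.
have E2 : block_mx 1%:M 0 (- B') 'X%:M *m N =
    block_mx 'X%:M A' 0 ('X%:M - B' *m A').
  rewrite mulmx_block !mul0mx !mul1mx !addr0 mulmx1 !mulNmx.
  by rewrite scalar_mxC addNr addrC.
have := congr1 determinant E1; have := congr1 determinant E2.
rewrite !det_mulmx !det_ublock !det_lblock !det1 !mul1r !mulr1 !det_scalar.
move=> e2 e1; rewrite /char_poly /char_poly_mx !map_mxM /= -e1 mulrC e2.
by [].
Qed.

Variable R : realType.
Local Notation C := R[i].

Lemma char_poly_spectral m (M : 'M[C]_m) : M \is normalmx ->
  char_poly M = \prod_(j < m) ('X - (spectral_diag M 0 j)%:P).
Proof.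
move/orthomx_spectralP => {1}->; rewrite -mulmxA.
have := char_poly_mulC (invmx (spectralmx M))
  (diag_mx (spectral_diag M) *m spectralmx M).
rewrite -(mulmxA (diag_mx _)) mulmxV ?spectral_unit // mulmx1 mulrC.
move/(mulfI (monic_neq0 (monicXn _ _))) => ->.
rewrite char_poly_trig ?diag_mx_is_trig //.
by apply: eq_bigr => j _; rewrite mxE eqxx mulr1n.
Qed.

Lemma char_poly2 (A : 'M[C]_2) a b : \tr A = a + b -> \det A = a * b ->
  char_poly A = ('X - a%:P) * ('X - b%:P).
Proof.
move=> trA detA; apply/polyP => i.
have [i2|i2] := ltnP i 2; last first.
  have [->|i3] := eqVneq i 2%N.
    have := char_poly_monic A; rewrite monicE lead_coefE size_char_poly /=.
    have : ('X - a%:P) * ('X - b%:P) \is monic.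
      by rewrite monicMl ?monicXsubC.
    rewrite monicE lead_coefE size_Mmonic ?monicXsubC ?polyXsubC_eq0 //.
    by rewrite !size_XsubC /= => /eqP -> /eqP ->.
  rewrite !nth_default ?size_char_poly ?size_Mmonic ?monicXsubC //;
    rewrite ?polyXsubC_eq0 ?size_XsubC //; lia.
have -> : ('X - a%:P) * ('X - b%:P) = 'X^2 - (a + b) *: 'X + (a * b)%:P.
  by rewrite -mul_polyC polyCD polyCM; ring.
rewrite coefD coefB coefZ coefXn coefX coefC.
case: i i2 => [_|[_|//]] /=.
  by rewrite char_poly_det sqrrN expr1n mul1r detA; ring.
by rewrite (char_poly_trace A (n := 2)) // trA; ring.
Qed.

(** A density matrix that factors through a plane has at most two nonzero
    eigenvalues, which are those of the reversed product. *)
Lemma von_neumann_rank2 m (L : 'M[C]_(m, 2)) (K : 'M[C]_(2, m)) (p : R) :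
    L *m K \is normalmx -> \tr (K *m L) = 1 ->
    \det (K *m L) = (p * (1 - p))%:C%C ->
  von_neumann (L *m K) = bin_entropy p.
Proof.
move=> nM trM detM.
have := char_poly_mulC L K.
rewrite (char_poly2 (a := p%:C%C) (b := (1 - p)%:C%C)); first last.
- by rewrite detM rmorphM.
- by rewrite trM -rmorphD addrC subrK.
rewrite (char_poly_spectral nM) => e.
pose s := [seq spectral_diag (L *m K) 0 j | j : 'I_m].
have : perm_eq (s ++ nseq 2 0) (nseq m 0 ++ [:: p%:C%C; (1 - p)%:C%C]).
  apply: prod_XsubC_eq; rewrite !big_cat big_map big_enum !big_nseq.
  by rewrite !iter_mulr_1 !subr0 big_cons big_seq1; apply: e.
move=> pe; have : \sum_(x <- s ++ nseq 2 0) entropy_term (complex.Re x) =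
    \sum_(x <- nseq m 0 ++ [:: p%:C%C; (1 - p)%:C%C])
       entropy_term (complex.Re x) by apply: perm_big.
have E0 : entropy_term (complex.Re (0 : C)) = 0 by apply: entropy_term0.
rewrite !big_cat big_map big_enum !big_nseq E0 !iter_addr !mul0rn /= !addr0 add0r.
by rewrite !big_cons big_nil addr0.
Qed.

End Spectrum.

Section ProductVectors.
Variables (R : realType) (k : nat) (d : 'I_k -> nat).
Local Notation C := R[i].
Local Notation legs := (forall i : 'I_k, 'cV[C]_(d i)).
Implicit Types (P : pred 'I_k) (f g u v : legs) (S : {set 'I_k}).

Lemma sum_dffun_prod (I : finType) (T : I -> finType) (F : forall i, T i -> C) :
  \sum_(x : {dffun forall i, T i}) \prod_i F i (x i) = \prod_i \sum_t F i t.
Proof.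
pose F' i := [ffun t => F i t].
transitivity (\prod_i \sum_(t : T i) F' i t); last first.
  by apply: eq_bigr => i _; apply: eq_bigr => t _; rewrite ffunE.
rewrite (reindex (@dffun_of_fprod _ T)); last first.
  exact/onW_bij/dffun_of_fprod_bij.
transitivity (\sum_(t : fprod T) \prod_(i in I) F' i (t i)).
  by apply: eq_bigr => t _; apply: eq_bigr => i _; rewrite !ffunE.
rewrite big_fprod.
transitivity (\prod_i \sum_(j in tagged_with T i) untag 0 (F' i) j).
  by rewrite bigA_distr_big_dep.
by apply: eq_bigr => i _; rewrite -(big_tag (fun i t => F' i t)).
Qed.

Definition dot n (a b : 'cV[C]_n) : C := \sum_x a x 0 * (b x 0)^*.

Definition pureS P f (x : sidx d P) : C := \prod_i f (val i) (x i) 0.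

Definition with_leg u v (j : 'I_k) : legs :=
  fun i => if i == j then v i else u i.

(** The vector with exactly one leg of [P] in the state [v] and the others in [u],
    summed over that leg. *)
Definition wS P u v (x : sidx d P) : C := \sum_(j | P j) pureS (with_leg u v j) x.

Definition ipS P (F G : sidx d P -> C) : C := \sum_x F x * (G x)^*.

Lemma ipS_pure P f g : ipS (pureS (P := P) f) (pureS g) = \prod_(i | P i) dot (f i) (g i).
Proof.
rewrite [RHS](big_sub (fun i => P i)) -sum_dffun_prod.
apply: eq_bigr => x _; rewrite rmorph_prod -big_split.
by apply: eq_bigr => i _.
Qed.

Lemma ipS_suml P (J : finType) (Q : pred J) (F : J -> sidx d P -> C) G :
  ipS (fun x => \sum_(j | Q j) F j x) G = \sum_(j | Q j) ipS (F j) G.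
Proof.
rewrite [RHS]exchange_big /=; apply: eq_bigr => x _.
by rewrite mulr_suml.
Qed.

Lemma ipSC P F G : ipS (P := P) F G = (ipS G F)^*.
Proof.
rewrite rmorph_sum; apply: eq_bigr => x _.
by rewrite rmorphM /= conjCK mulrC.
Qed.

Section Orthogonal.
Variables u v : legs.
Hypothesis vu0 : forall i, dot (v i) (u i) = 0.
Variable P : pred 'I_k.

Lemma ipS_w_pure : ipS (wS (P := P) u v) (pureS u) = 0.
Proof.
rewrite ipS_suml big1 // => j Pj; rewrite ipS_pure (bigD1 j) //=.
by rewrite /with_leg eqxx vu0 mul0r.
Qed.

Lemma ipS_w_w (t : 'I_k -> C) :
    (forall i, dot (v i) (v i) = t i * dot (u i) (u i)) ->
  ipS (wS (P := P) u v) (wS u v) =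
  (\sum_(j | P j) t j) * ipS (pureS (P := P) u) (pureS u).
Proof.
move=> tE; rewrite ipS_suml mulr_suml; apply: eq_bigr => j Pj.
rewrite ipSC ipS_suml (bigD1 j) //= big1 => [|i /andP[Pi ij]]; last first.
  rewrite ipS_pure (bigD1 j) //= /with_leg eqxx eq_sym (negPf ij).
  suff -> : dot (u j) (v j) = 0 by rewrite mul0r.
  have -> : dot (u j) (v j) = (dot (v j) (u j))^*.
    rewrite rmorph_sum; apply: eq_bigr => x _.
    by rewrite rmorphM /= conjCK mulrC.
  by rewrite vu0 rmorph0.
rewrite addr0 -ipSC !ipS_pure (bigD1 j) //= [in RHS](bigD1 j) //= mulrA -tE.
rewrite /with_leg eqxx; congr (_ * _); apply: eq_bigr => i /andP[_ /negPf ij].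
by rewrite ij.
Qed.

End Orthogonal.

Section Flattening.
Variable S : {set 'I_k}.
Local Notation sS := (sidx d (fun i => i \in S)).
Local Notation sT := (sidx d (fun i => i \notin S)).

Lemma boolP_in T (b : bool) (F : b -> T) (G : ~~ b -> T) (h : b) :
  match boolP b with AltTrue h' => F h' | AltFalse h' => G h' end = F h.
Proof.
refine (match boolP b as s return
  match s with AltTrue h' => F h' | AltFalse h' => G h' end = F h with
  | AltTrue h' => congr1 F (bool_irrelevance h' h)
  | AltFalse h' => _ end).
by exfalso; move: h'; rewrite h.
Qed.

Lemma boolP_out T (b : bool) (F : b -> T) (G : ~~ b -> T) (h : ~~ b) :
  match boolP b with AltTrue h' => F h' | AltFalse h' => G h' end = G h.
Proof.
refine (match boolP b as s return
  match s with AltTrue h' => F h' | AltFalse h' => G h' end = G h with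
  | AltTrue h' => _
  | AltFalse h' => congr1 G (bool_irrelevance h' h) end).
by exfalso; move: h; rewrite h'.
Qed.

Lemma merge_in (a : sS) (b : sT) (i : {i | i \in S}) :
  Defs.merge a b (val i) = a i.
Proof. by rewrite ffunE; case: i => i iS /=; rewrite boolP_in. Qed.

Lemma merge_out (a : sS) (b : sT) (i : {i | i \notin S}) :
  Defs.merge a b (val i) = b i.
Proof. by rewrite ffunE; case: i => i iS /=; rewrite boolP_out. Qed.

Lemma merge_bij : bijective (fun p : sS * sT => Defs.merge p.1 p.2).
Proof.
pose inv (x : idx d) : sS * sT := ([ffun i => x (val i)], [ffun i => x (val i)]).
exists inv => [[a b]|x].
  by congr pair; apply/ffunP => i; rewrite ffunE ?merge_in ?merge_out.
apply/ffunP => i; have [iS|iS] := boolP (i \in S).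
  by rewrite (merge_in _ _ (exist _ i iS)) ffunE.
by rewrite (merge_out _ _ (exist _ i iS)) ffunE.
Qed.

Lemma prod_merge (f : legs) (a : sS) (b : sT) :
  \prod_i f i (Defs.merge a b i) 0 = pureS f a * pureS f b.
Proof.
rewrite (bigID (fun i => i \in S)) /= [X in X * _](big_sub (fun i => i \in S)).
rewrite [X in _ * X](big_sub (fun i => i \notin S)); congr (_ * _).
  by apply: eq_bigr => i _; rewrite merge_in.
by apply: eq_bigr => i _; rewrite merge_out.
Qed.

End Flattening.
End ProductVectors.

Section RankTwoFlattening.
Variables (R : realType) (k : nat) (d : 'I_k -> nat).
Local Notation C := R[i].
Local Notation legs := (forall i : 'I_k, 'cV[C]_(d i)).
Variables (u v : legs) (al : C) (t : 'I_k -> R).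
Hypothesis vu0 : forall i, dot (v i) (u i) = 0.
Hypothesis uu_gt0 : forall i, 0 < dot (u i) (u i).
Hypothesis tE : forall i, dot (v i) (v i) = (t i)%:C%C * dot (u i) (u i).
Hypothesis t_gt0 : 0 < \sum_j t j.

(** The shape of all tensors in the orbit of the W tensor, after [A e_2] has been
    made orthogonal to [A e_1] on every leg: the parallel components add up to the
    coefficient [al] of the product vector. *)
Definition w_vector : tensor R d :=
  [ffun x : idx d => \sum_j \prod_i with_leg u v j i (x i) 0 + al * \prod_i u i (x i) 0].

Variable S : {set 'I_k}.
Local Notation PS := (fun i => i \in S).
Local Notation PT := (fun i => i \notin S).

Lemma w_vector_merge (a : sidx d PS) (b : sidx d PT) :
  w_vector (Defs.merge a b) =
  pureS u a * (wS u v b + al * pureS u b) + wS u v a * pureS u b.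
Proof.
have sw (P : pred 'I_k) (x : sidx d P) j : ~~ P j ->
    pureS (with_leg u v j) x = pureS u x.
  move=> Pj; apply: eq_bigr => i _; rewrite /with_leg.
  by case: eqP => // ij; move: Pj; rewrite -ij (valP i).
rewrite ffunE prod_merge (bigID PS) /=.
have -> : \sum_(j in S) \prod_i with_leg u v j i (Defs.merge a b i) 0 =
    wS u v a * pureS u b.
  rewrite /wS mulr_suml; apply: eq_bigr => j jS.
  by rewrite prod_merge (sw _ b) ?jS.
have -> : \sum_(j | j \notin S) \prod_i with_leg u v j i (Defs.merge a b i) 0 =
    pureS u a * wS u v b.
  rewrite /wS mulr_sumr; apply: eq_bigr => j jS.
  by rewrite prod_merge (sw _ a).
by ring.
Qed.

Local Notation m := #|{: sidx d PS}|.
Local Notation m' := #|{: sidx d PT}|.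

Let L : 'M[C]_(m, 2) := \matrix_(i, j)
  if j == 0 then pureS u (enum_val i) else wS u v (enum_val i).
Let K0 : 'M[C]_(2, m') := \matrix_(i, j)
  if i == 0 then wS u v (enum_val j) + al * pureS u (enum_val j)
  else pureS u (enum_val j).

Lemma flattening_w_vector : flattening S w_vector = L *m K0.
Proof.
apply/matrixP => i j; rewrite !mxE w_vector_merge big_ord_recl big_ord1.
by rewrite !mxE.
Qed.

Let N := ipS (P := PS) (pureS u) (pureS u).
Let N' := ipS (P := PT) (pureS u) (pureS u).
Let tS := \sum_(j | j \in S) t j.
Let tT := \sum_(j | j \notin S) t j.

Lemma sum_enum_val (T : finType) (F : T -> C) :
  \sum_(i < #|{: T}|) F (enum_val i) = \sum_x F x.
Proof. by rewrite [RHS](reindex _ (onW_bij _ (@enum_val_bij T))). Qed.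

Lemma gramL i j : ((map_mx Num.conj L^T) *m L) i j =
  if i == j then if i == 0 then N else (tS%:C)%C * N else 0.
Proof.
have sumE (F G : sidx d PS -> C) : \sum_(x < m) (F (enum_val x))^* * G (enum_val x) = ipS G F.
  rewrite (sum_enum_val (fun x => (F x)^* * G x)).
  by apply: eq_bigr => x _; rewrite mulrC.
have wu := ipS_w_pure vu0 PS; have ww := ipS_w_w vu0 PS tE.
rewrite !mxE.
case: i => [[|[|//]] i2]; case: j => [[|[|//]] j2]; rewrite /=.
- under eq_bigr => x _ do rewrite !mxE /=.
  by rewrite sumE.
- under eq_bigr => x _ do rewrite !mxE /=.
  by rewrite sumE.
- under eq_bigr => x _ do rewrite !mxE /=.
  by rewrite sumE ipSC wu rmorph0.
- under eq_bigr => x _ do rewrite !mxE /=.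
  by rewrite sumE ww -rmorph_sum.
Qed.

Lemma gramK i j : (K0 *m (map_mx Num.conj K0^T)) i j =
  if i == 0 then if j == 0 then (tT%:C%C + al * al^*) * N' else al * N'
  else if j == 0 then al^* * N' else N'.
Proof.
have wu := ipS_w_pure vu0 PT; have ww := ipS_w_w vu0 PT tE.
have uw : ipS (P := PT) (pureS u) (wS u v) = 0 by rewrite ipSC wu rmorph0.
have addl (F G H : sidx d PT -> C) : ipS (P := PT) (fun x => F x + al * G x) H =
    ipS F H + al * ipS G H.
  rewrite /ipS mulr_sumr -big_split; apply: eq_bigr => x _ /=.
  by rewrite mulrDl mulrA.
have addr (F G H : sidx d PT -> C) : ipS (P := PT) H (fun x => F x + al * G x) =
    ipS H F + al^* * ipS H G.
  by rewrite ipSC addl rmorphD rmorphM /= -!ipSC.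
have sumE (F G : sidx d PT -> C) : \sum_(x < m') F (enum_val x) * (G (enum_val x))^* = ipS F G.
  by rewrite (sum_enum_val (fun x => F x * (G x)^*)).
rewrite !mxE.
case: i => [[|[|//]] i2]; case: j => [[|[|//]] j2]; rewrite /=.
- under eq_bigr => x _ do rewrite !mxE /=.
  rewrite (sumE (fun x => wS u v x + al * pureS u x)
                (fun x => wS u v x + al * pureS u x)).
  by rewrite addl !addr uw wu ww -rmorph_sum /= -/N'; ring.
- under eq_bigr => x _ do rewrite !mxE /=.
  rewrite (sumE (fun x => wS u v x + al * pureS u x)).
  by rewrite addl wu add0r.
- under eq_bigr => x _ do rewrite !mxE /=.
  rewrite (sumE _ (fun x => wS u v x + al * pureS u x)).
  by rewrite addr uw add0r.
- under eq_bigr => x _ do rewrite !mxE /=.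
  by rewrite sumE.
Qed.

Lemma ipS_pure_gt0 (P : pred 'I_k) : 0 < ipS (P := P) (pureS u) (pureS u).
Proof. by rewrite ipS_pure prodr_gt0. Qed.

Lemma norm_w_vector : \sum_x `|w_vector x| ^+ 2 =
  \tr ((K0 *m (map_mx Num.conj K0^T)) *m ((map_mx Num.conj L^T) *m L)).
Proof.
rewrite (reindex _ (onW_bij _ (merge_bij d S))) /=.
rewrite mulmxA mxtrace_mulC !mulmxA -flattening_w_vector.
rewrite -mulmxA -map_mxM -trmx_mul -flattening_w_vector /mxtrace.
under [RHS]eq_bigr => i _.
  rewrite mxE; under eq_bigr => j _ do rewrite !mxE.
  rewrite (sum_enum_val (fun b => w_vector (Defs.merge (enum_val i) b) *
    (w_vector (Defs.merge (enum_val i) b))^*)).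
  over.
rewrite (sum_enum_val (fun a => \sum_b w_vector (Defs.merge a b) *
    (w_vector (Defs.merge a b))^*)) pair_bigA /=.
by apply: eq_bigr => p _; rewrite normCK.
Qed.

Lemma det2 (A : 'M[C]_2) : \det A = A 0 0 * A 1 1 - A 0 1 * A 1 0.
Proof.
rewrite (expand_det_row _ 0) !big_ord_recl big_ord0 /cofactor !det_mx11 !mxE.
rewrite /= expr0 expr1 mul1r addr0 mulN1r mulrN.
by congr (A _ _ * A _ _ - A _ _ * A _ _); apply: val_inj.
Qed.

(** Across [S], the flattening of [w_vector] is a product [L K0] through the plane
    spanned by the product vector and the one-excitation vector on [S], which are
    orthogonal.  By Sylvester's identity the nonzero spectrum is that of a product
    of two 2 x 2 Gram matrices.  The admixture [al] drops out of their
    determinants and enters the norm only. *)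
Lemma entropy_w_vector (p : R) :
    p * (1 - p) = tS * tT / (\sum_j t j + (complex.Re (`|al| ^+ 2))) ^+ 2 ->
  von_neumann (density S w_vector) = bin_entropy p.
Proof.
move=> pE; set c := (\sum_x `|w_vector x| ^+ 2)^-1.
set a2 := complex.Re _ in pE.
have aE : al * al^* = a2%:C%C.
  by rewrite -normCK RRe_real // ger0_real // exprn_ge0.
have a0 : 0 <= a2 by rewrite -lecR -aE mul_conjC_ge0.
have N0 : 0 < N := ipS_pure_gt0 _.
have N'0 : 0 < N' := ipS_pure_gt0 _.
set G := (K0 *m map_mx Num.conj K0^T) *m (map_mx Num.conj L^T *m L).
have trG : \tr G = N * N' * (\sum_j t j + a2)%:C%C.
  rewrite /mxtrace big_ord_recl big_ord1 !mxE !big_ord_recl !big_ord0.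
  rewrite !gramK !gramL /= aE [in RHS](bigID PS) /= -/tS -/tT !rmorphD /=; ring.
have detG : \det G = (tS * tT)%:C%C * (N * N') ^+ 2.
  rewrite det_mulmx !det2 !gramK !gramL /= rmorphM /=; ring.
have cE : c = (\tr G)^-1 by rewrite /c norm_w_vector.
have s0 : 0 < \sum_j t j + a2 by rewrite ltr_wpDr.
have sC0 : (\sum_j t j + a2)%:C%C != 0 by rewrite gt_eqF // ltcR.
have trn0 : \tr G != 0 by rewrite trG !mulf_neq0 ?gt_eqF // ltcR.
pose K : 'M[C]_(2, m) := c *: (K0 *m map_mx Num.conj K0^T *m map_mx Num.conj L^T).
have dE : density S w_vector = L *m K.
  rewrite /density -/c flattening_w_vector trmx_mul map_mxM /= /K.
  by rewrite -!scalemxAr !mulmxA.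
have KL : K *m L = c *: G by rewrite /K -scalemxAl /G !mulmxA.
rewrite dE; apply: von_neumann_rank2.
- rewrite -dE qualifE /density; apply/eqP.
  suff -> : ((density S w_vector)^t*)%sesqui = density S w_vector by [].
  rewrite /density linearZ /= map_mxZ trmx_mul map_mxM /=.
  rewrite map_trmx trmxK -map_mx_comp map_mx_id => [|x /=]; last exact: conjCK.
  congr (_ *: _); apply/CrealP/ger0_real; rewrite invr_ge0.
  by apply: sumr_ge0 => x _; apply: exprn_ge0.
- by rewrite KL mxtraceZ cE mulVf.
rewrite KL detZ detG cE trG pE [in RHS]rmorphM fmorphV rmorphXn /=.
move: sC0 (tS * tT)%:C%C; move: (_ + _)%:C%C => s sC0 r.
by field; rewrite sC0 !gt_eqF.
Qed.
End RankTwoFlattening.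

Section Orbit.
Variable R : realType.
Local Notation C := R[i].
Local Notation d := (fun _ : 'I_4 => 2%N).
Implicit Types (A : 'I_4 -> 'M[C]_2) (p : 'I_4 -> R).

Lemma dot_ge0 n (a : 'cV[C]_n) : 0 <= dot a a.
Proof. by apply: sumr_ge0 => x _; rewrite mul_conjC_ge0. Qed.

Lemma dot_eq0 n (a : 'cV[C]_n) : (dot a a == 0) = (a == 0).
Proof.
apply/idP/eqP => [|->]; last first.
  by rewrite /dot big1 // => x _; rewrite mxE mul0r.
rewrite psumr_eq0 => [/allP h|x _]; last exact: mul_conjC_ge0.
apply/matrixP => x y; rewrite ord1 mxE.
by have := h x (mem_index_enum x); rewrite mul_conjC_eq0 => /eqP.
Qed.

Lemma dot_gt0 n (a : 'cV[C]_n) : a != 0 -> 0 < dot a a.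
Proof. by move=> a0; rewrite lt0r dot_eq0 a0 dot_ge0. Qed.

Lemma gl_act_W4 A : gl_act A (W4 R) =
  [ffun x : idx d => \sum_j \prod_i
     with_leg (fun i => A i *m e1 R) (fun i => A i *m e2 R) j i (x i) 0].
Proof.
apply/ffunP => x; rewrite !ffunE.
under eq_bigr => y _ do rewrite sum_ffunE mulr_sumr.
rewrite exchange_big /=; apply: eq_bigr => j _.
pose F (i : 'I_4) (t : 'I_2) : C :=
  A i (x i) t * (if i == j then e2 R else e1 R) t 0.
transitivity (\sum_(y : idx d) \prod_i F i (y i)).
  by apply: eq_bigr => y _; rewrite ffunE -big_split.
rewrite (@sum_dffun_prod R _ (fun i : 'I_4 => 'I_2) F).
by apply: eq_bigr => i _; rewrite /with_leg /F; case: eqP => _; rewrite mxE.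
Qed.

Lemma sum_with_leg k (e : 'I_k -> nat) (u v w : forall i, 'cV[C]_(e i))
    (al : 'I_k -> C) (x : forall i, 'I_(e i)) :
    (forall i, v i = al i *: u i + w i) ->
  \sum_j \prod_i with_leg u v j i (x i) 0 =
  \sum_j \prod_i with_leg u w j i (x i) 0 +
    (\sum_j al j) * \prod_i u i (x i) 0.
Proof.
move=> vE; rewrite mulr_suml -big_split; apply: eq_bigr => j _ /=.
rewrite (bigD1 j) //= [in RHS](bigD1 j) //= [X in al j * X](bigD1 j) //=.
have rest v' : \prod_(i < k | i != j) with_leg u v' j i (x i) 0 =
    \prod_(i < k | i != j) u i (x i) 0.
  by apply: eq_bigr => i /negPf ij; rewrite /with_leg ij.
rewrite !rest /with_leg eqxx vE !mxE; ring.
Qed.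

(** Rescaling [e_2] by the square roots of the [p j] gives the W tensor the
    excitation probabilities [p j]. *)
Lemma orbit_entropy_diag p : (forall j, 0 < p j) -> \sum_j p j = 1 ->
  exists2 A, (forall j, A j \in unitmx) &
    forall b, H_ b (gl_act A (W4 R)) = bin_entropy (\sum_(j in side b) p j).
Proof.
move=> p0 p1; pose D (a : C) : 'M[C]_2 := diag_mx (\row_j if j == 0 then 1 else a).
pose s j : C := (Num.sqrt (p j))%:C%C.
have s0 j : s j != 0 by rewrite gt_eqF // ltcR sqrtr_gt0.
have De1 a : D a *m e1 R = e1 R.
  apply/matrixP => x y; rewrite mul_diag_mx !mxE.
  by case: (x == 0); rewrite ?mul1r ?mulr0.
have De2 a : D a *m e2 R = a *: e2 R.
  apply/matrixP => x y; rewrite mul_diag_mx !mxE.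
  by case: x => [[|[|//]] xl] /=; rewrite ?mulr0.
exists (fun j => D (s j)) => [j|b].
  rewrite unitmxE det_diag big_ord_recl big_ord1 !mxE /= mul1r unitfE.
  exact: s0.
have dotE (x y : 'I_2) (c : C) : dot (c *: delta_mx x 0) (delta_mx y 0 : 'cV_2) =
    c * (x == y)%:R.
  rewrite /dot (bigD1 y) //= !mxE !eqxx rmorph1 mulr1 big1 => [|z zy].
    by rewrite andbT addr0 eq_sym.
  by rewrite !mxE (negPf zy) rmorph0 mulr0.
have dotE1 : dot (e1 R) (e1 R) = 1.
  by rewrite -{1}[e1 R]scale1r dotE eqxx mulr1.
have E : gl_act (fun j => D (s j)) (W4 R) =
    w_vector (fun _ : 'I_4 => e1 R) (fun i => s i *: e2 R) 0.
  rewrite gl_act_W4; apply/ffunP => x; rewrite !ffunE mul0r addr0.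
  apply: eq_bigr => j _; apply: eq_bigr => i _; rewrite /with_leg De1 De2.
  by [].
rewrite /H_ E; apply: (@entropy_w_vector R 4 d _ _ 0 p).
- by move=> i; rewrite dotE mulr0.
- by move=> i; rewrite dotE1 ltr01.
- move=> i; rewrite dotE1 mulr1 {1}/dot.
  have -> : \sum_x (s i *: e2 R) x 0 * ((s i *: e2 R) x 0)^* =
      s i * (s i)^* * dot (e2 R) (e2 R).
    rewrite mulr_sumr; apply: eq_bigr => x _.
    by rewrite !mxE rmorphM /= mulrACA.
  rewrite -{1}[e2 R]scale1r dotE eqxx !mulr1 conj_Creal; last first.
    by apply/ger0_real; rewrite lecR sqrtr_ge0.
  rewrite /s -rmorphM /=.
  by rewrite -expr2 sqr_sqrtr // ltW.
- by rewrite p1.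
rewrite normr0 expr0n /= addr0 p1 expr1n divr1; congr (_ * _).
by rewrite -p1 [X in X - _](bigID (fun j => j \in side b)) /= addrAC subrr add0r.
Qed.

(** For general [A], the probabilities are proportional to the squared lengths of
    the components of [A e_2] orthogonal to [A e_1], relative to [A e_1].  The
    parallel components only decrease the determinants of the reduced density
    matrices. *)
Lemma orbit_entropy_le A : (forall j, A j \in unitmx) ->
  exists2 p, (forall j, 0 <= p j) /\ \sum_j p j = 1 &
    forall b, H_ b (gl_act A (W4 R)) <= bin_entropy (\sum_(j in side b) p j).
Proof.
move=> uA; pose u i := A i *m e1 R; pose v i := A i *m e2 R.
pose al i := dot (v i) (u i) / dot (u i) (u i).
pose w i := v i - al i *: u i.
have A0 i (x : 'cV[C]_2) : A i *m x = 0 -> x = 0.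
  by move=> Ax; rewrite -(mulKmx (uA i) x) Ax mulmx0.
have u0 i : u i != 0.
  apply/eqP => /A0/matrixP/(_ 0 0); rewrite !mxE /= => /eqP.
  by rewrite oner_eq0.
have w0 i : w i != 0.
  apply/eqP; rewrite /w /v /u scalemxAr -mulmxBr => /A0/matrixP/(_ 1 0).
  by rewrite !mxE /= mulr0 subr0 => /eqP; rewrite oner_eq0.
have uu0 i := dot_gt0 (u0 i); have ww0 i := dot_gt0 (w0 i).
have wu i : dot (w i) (u i) = 0.
  transitivity (dot (v i) (u i) - al i * dot (u i) (u i)); last first.
    by rewrite divfK ?subrr // gt_eqF.
  rewrite /dot mulr_sumr -sumrB; apply: eq_bigr => x _.
  by rewrite !mxE mulrBl mulrA.
pose t i := complex.Re (dot (w i) (w i) / dot (u i) (u i)).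
have tC i : (t i)%:C%C = dot (w i) (w i) / dot (u i) (u i).
  by rewrite RRe_real // ger0_real // ltW // divr_gt0.
have t0 i : 0 < t i by rewrite -ltcR tC divr_gt0.
have T0 : 0 < \sum_j t j.
  by rewrite big_ord_recl ltr_pwDl // sumr_ge0 // => j _; apply: ltW.
have E : gl_act A (W4 R) = w_vector u w (\sum_j al j).
  rewrite gl_act_W4; apply/ffunP => x; rewrite !ffunE.
  by apply: sum_with_leg => i; rewrite /w addrC subrK.
set T := \sum_j t j in T0; set a := complex.Re (`|\sum_j al j| ^+ 2).
have a0 : 0 <= a.
  have al0 : 0 <= `|\sum_j al j| ^+ 2 by apply: exprn_ge0.
  by rewrite -lecR RRe_real ?ger0_real.
exists (fun j => t j / T) => [|b].
  split=> [j|]; first by rewrite divr_ge0 // ltW.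
  by rewrite -mulr_suml divff // gt_eqF.
rewrite -mulr_suml; set tS := \sum_(j in _) _.
set tT := \sum_(j | j \notin side b) t j.
have TE : T = tS + tT by rewrite /T (bigID (fun j => j \in side b)).
have tS0 : 0 <= tS by apply: sumr_ge0 => j _; apply: ltW.
have tT0 : 0 <= tT by apply: sumr_ge0 => j _; apply: ltW.
pose de := tS * tT / (T + a) ^+ 2.
have Ta0 : 0 < T + a by lra.
have de0 : 0 <= de.
  by apply: divr_ge0; [apply: mulr_ge0 | apply: exprn_ge0; lra].
have deT : de <= tS / T * (1 - tS / T).
  have -> : tS / T * (1 - tS / T) = tS * tT / T ^+ 2.
    by rewrite TE; field; rewrite -TE gt_eqF.
  apply: ler_wpM2l; first exact: mulr_ge0.
  by rewrite lef_pV2 ?posrE ?exprn_gt0 // !expr2; nra.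
have de4 : 4 * de <= 1 by have := sqr_ge0 (1 - 2 * (tS / T)); rewrite expr2; nra.
(* [la] is the smaller root of [x (1 - x) = de]. *)
pose q := Num.sqrt (1 - 4 * de).
have q0 : 0 <= q by apply: sqrtr_ge0.
have qE : q ^+ 2 = 1 - 4 * de by rewrite sqr_sqrtr // subr_ge0.
have q1 : q <= 1 by rewrite expr2 in qE; nra.
pose la := (1 - q) / 2.
have laE : la * (1 - la) = de by rewrite /la; rewrite expr2 in qE; lra.
have -> : H_ b (gl_act A (W4 R)) = bin_entropy la.
  rewrite /H_ E; apply: (entropy_w_vector wu uu0 (t := t)) => //.
  by move=> i; rewrite tC divfK // gt_eqF.
apply: bin_entropy_mono; first by rewrite /la; lra.
  by rewrite divr_ge0 ?ler_pdivrMr // ?mul1r; lra.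
by rewrite laE.
Qed.

End Orbit.

(** * Excitation numbers of a nonvanishing projection *)

Section Weights.
Variables (k n : nat).
Local Notation d := (fun _ : 'I_k => 2%N).
Local Notation word := {ffun 'I_n -> idx d}.
Implicit Types (S : {set 'I_k}) (x : idx d) (X Y : word).

Definition exc S x : nat := \sum_(i in S) x i.
Definition weight S X : nat := \sum_(m < n) exc S (X m).

Lemma weightE S X : weight S X = (\sum_(i in S) \sum_(m < n) X m i)%N.
Proof. by rewrite /weight exchange_big. Qed.

Lemma weight_perm S S' g X : weight S (perm_idx S' g X) = weight S X.
Proof.
rewrite !weightE; apply: eq_bigr => i _.
have [iS'|/negPf iS'] := boolP (i \in S').
  rewrite [RHS](reindex_inj (@perm_inj _ g)) /=.
  by apply: eq_bigr => m _; rewrite !ffunE iS'.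
by apply: eq_bigr => m _; rewrite !ffunE iS'.
Qed.

Lemma exc_perm S S' g X m : S \subset S' ->
  exc S (perm_idx S' g X m) = exc S (X (g m)).
Proof.
move/fintype.subsetP => SS'; apply: eq_bigr => i iS.
by rewrite !ffunE SS'.
Qed.

Lemma excC S x : exc [set: 'I_k] x = (exc S x + exc (~: S) x)%N.
Proof.
rewrite /exc (bigID (fun i => i \in S)) /=; congr (_ + _)%N.
  by apply: eq_bigl => i; rewrite inE.
by apply: eq_bigl => i; rewrite !inE.
Qed.

Variable R : realType.
Local Notation C := R[i].
Local Notation T := (ptensor R d n).

(** Tensors that on the legs [S] live in the [n]-th power of the plane spanned
    by the vacuum and the symmetric one-excitation vector. *)
Definition in_plane S (z : T) :=
  (forall X Y, (forall m i, i \notin S -> X m i = Y m i) ->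
     (forall m, exc S (X m) = exc S (Y m)) -> z X = z Y) /\
  (forall X m, z X != 0 -> (exc S (X m) <= 1)%N).

Lemma in_plane_act S g z : in_plane S z -> in_plane S (sym_act R d S g z).
Proof.
move=> [z1 z2]; split=> [X Y out inn|X m].
  rewrite !sym_actE !ffunE; apply: z1 => m.
    by move=> i /[dup] iS /negPf iS'; rewrite !ffunE iS' out.
  by rewrite !exc_perm // inn.
rewrite sym_actE ffunE => h; have := z2 _ (g^-1%g m) h.
by rewrite exc_perm // permKV.
Qed.

Lemma in_plane_sum S (J : finType) (P : pred J) (c : J -> C) (z : J -> T) :
  (forall j, in_plane S (z j)) -> in_plane S (\sum_(j | P j) c j *: z j).
Proof.
move=> zj; split=> [X Y out inn|X m].
  rewrite !sum_ffunE; apply: eq_bigr => j _; rewrite !ffunE; congr (_ *: _).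
  by case: (zj j) => + _; apply.
rewrite sum_ffunE; apply: contra_neqT => h; apply: big1 => j _.
rewrite ffunE; have [->|nz] := eqVneq (z j X) 0; first exact: scaler0.
by case: (zj j) => _ /(_ X m nz); rewrite (negPf h).
Qed.

Lemma in_plane_cutoff S (Q : pred word) z :
    (forall X Y, (forall m, exc S (X m) = exc S (Y m)) -> Q X = Q Y) ->
  in_plane S z -> in_plane S (cutoff R Q z).
Proof.
move=> QE [z1 z2]; split=> [X Y out inn|X m]; rewrite !cutoffE.
  by rewrite (QE _ _ inn) (z1 _ _ out inn).
by case: ifP => _; [apply: z2 | rewrite eqxx].
Qed.

Section Young.
Variables (S : {set 'I_k}) (la : seq nat).
Hypothesis la_part : is_partition n la.
Hypothesis n_gt0 : (0 < n)%N.
Variable y : T.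
Hypothesis y_plane : in_plane S y.
Hypothesis y_anti : forall q, q \in col_stab n la ->
  sym_act R d S q y = ((-1) ^+ odd_perm q : C) *: y.
Variable X : word.
Hypothesis yX : y X != 0.

(** Equal excitation numbers in one column would make [y] both symmetric and
    antisymmetric under the transposition of the two boxes. *)
Lemma exc_column_inj (m m' : 'I_n) : m != m' ->
    reshape_offset la m = reshape_offset la m' ->
  exc S (X m) != exc S (X m').
Proof.
move=> mm' col; apply/eqP => e.
pose q := tperm m m'.
have qC : q \in col_stab n la.
  rewrite inE; apply/forallP => l; rewrite /q.
  by case: tpermP => [->|->|_ _]; rewrite ?col.
have := y_anti qC; rewrite odd_tperm mm' expr1 scaleN1r sym_actE.
move/ffunP/(_ X); rewrite !ffunE.
rewrite (_ : y (perm_idx S q X) = y X); last first.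
  case: y_plane => + _; apply=> [l i /negPf iS|l]; first by rewrite !ffunE iS.
  by rewrite exc_perm // /q; case: tpermP => // ->.
move/eqP; rewrite -subr_eq0 opprK -mulr2n mulrn_eq0 /=.
by rewrite (negPf yX).
Qed.

Lemma position_lt r c : (c < nth 0 la r)%N -> (flatten_index la r c < n)%N.
Proof. by case/and3P: la_part => _ _ /eqP <-; apply: flatten_indexP. Qed.

Definition position r c (h : (c < nth 0 la r)%N) : 'I_n :=
  Ordinal (position_lt h).

Lemma exc_column r r' c (h : (c < nth 0 la r)%N) (h' : (c < nth 0 la r')%N) :
  r != r' -> exc S (X (position h)) != exc S (X (position h')).
Proof.
move=> rr'; apply: exc_column_inj; last by rewrite /= !flatten_indexKr.
apply: contra_neq rr' => /(congr1 (reshape_index la \o val)) /=.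
by rewrite !flatten_indexKl.
Qed.

Lemma exc_le1 m : (exc S (X m) <= 1)%N.
Proof. by case: y_plane => _; apply. Qed.

(** A column holds pairwise distinct excitation numbers out of [0] and [1].  So
    there are at most two rows, and every column of length two contributes exactly
    one excitation to the weight. *)
Lemma young_two_rows : exists m, [/\ la = two_rows n m, (m <= n - m)%N,
  (m <= weight S X)%N & (weight S X <= n - m)%N].
Proof.
case/and3P: (la_part) => la_sorted la0 /eqP la_sum.
have la_pos r : (r < size la)%N -> (0 < nth 0 la r)%N.
  by move=> h; rewrite lt0n; apply: contraNneq la0 => <-; apply: mem_nth.
have size_le2 : (size la <= 2)%N.
  rewrite leqNgt; apply/negP => s3.
  have h0 := la_pos 0%N (ltn_trans (isT : 0 < 2)%N s3).
  have h1 := la_pos 1%N (ltn_trans (isT : 1 < 2)%N s3).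
  have h2 := la_pos 2%N s3.
  have := exc_column h0 h1 isT; have := exc_column h0 h2 isT.
  have := exc_column h1 h2 isT.
  have := exc_le1 (position h0); have := exc_le1 (position h1).
  have := exc_le1 (position h2); lia.
have wn : (weight S X <= n)%N.
  rewrite -[leqRHS]card_ord -sum1_card; apply: leq_sum => m _.
  exact: exc_le1.
have [[l la1]|[a [b lab]]|la00] :
    [\/ exists l, la = [:: l], exists a b, la = [:: a; b] | la = [::]].
  move: size_le2; case: (la) => [|a [|b [|c s]]] // _; first by apply: Or33.
    by apply: Or31; exists a.
  by apply: Or32; exists a, b.
- have ln : l = n by rewrite -la_sum la1 /= addn0.
  by exists 0%N; rewrite /two_rows eqxx subn0 la1 ln.
- have h0 c : (c < a)%N -> (c < nth 0 la 0)%N by rewrite lab.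
  have h1 c : (c < b)%N -> (c < nth 0 la 1)%N by rewrite lab.
  have b0 : (0 < b)%N by have := la_pos 1%N; rewrite lab; apply.
  have ba : (b <= a)%N by move: la_sorted; rewrite lab /= andbT.
  have nE : n = (a + b)%N by rewrite -la_sum lab /= addn0.
  have nb : (n - b = a)%N by rewrite nE addnK.
  exists b; rewrite /two_rows gtn_eqF // nb.
  pose E (c : nat) := if insub c is Some m then exc S (X m) else 0%N.
  have EE (m : 'I_n) : E m = exc S (X m) by rewrite /E valK.
  have E0 c (ca : (c < a)%N) : E c = exc S (X (position (h0 _ ca))).
    by rewrite -EE /= /flatten_index take0 /=.
  have E1 c (cb : (c < b)%N) : E (a + c)%N = exc S (X (position (h1 _ cb))).
    by rewrite -EE /= /flatten_index lab /= addn0.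
  have wE : weight S X = (\sum_(0 <= c < b) (E c + E (a + c)) +
                          \sum_(b <= c < a) E c)%N.
    have -> : weight S X = (\sum_(m < n) E m)%N by apply: eq_bigr => m _.
    have -> : (\sum_(0 <= c < b) (E c + E (a + c)) =
        \sum_(0 <= c < b) E c + \sum_(a <= c < n) E c)%N.
      rewrite big_split /=; congr (_ + _)%N.
      rewrite -{2}[a]add0n big_addn nE addKn.
      by apply: eq_bigr => c _; rewrite addnC.
    rewrite addnAC -(big_cat_nat (n := b)) // -(big_cat_nat (n := a)) //=.
      by rewrite big_mkord.
    by rewrite nE leq_addr.
  have pairs : (\sum_(0 <= c < b) (E c + E (a + c)) = b)%N.
    rewrite -[RHS]subn0 -[RHS]muln1 -sum_nat_const_nat; apply: eq_big_nat => c.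
    move=> /= cb; have ca := leq_trans cb ba.
    rewrite (E0 _ ca) (E1 _ cb).
    have := exc_column (h0 _ ca) (h1 _ cb) isT.
    have := exc_le1 (position (h0 _ ca)); have := exc_le1 (position (h1 _ cb)).
    lia.
  have rest : (\sum_(b <= c < a) E c <= a - b)%N.
    rewrite -[leqRHS]muln1 -sum_nat_const_nat big_nat [leqRHS]big_nat.
    by apply: leq_sum => c /andP[_ ca]; rewrite (E0 _ ca) exc_le1.
  rewrite wE pairs; split=> //; lia.
- by move: n_gt0; rewrite -{1}la_sum la00.
Qed.

End Young.
End Weights.

Section Obstruction.
Variables (R : realType) (k n : nat).
Local Notation C := R[i].
Local Notation d := (fun _ : 'I_k => 2%N).
Local Notation T := (ptensor R d n).
Local Notation act S := (@sym_act R k d n S).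
Hypothesis n_gt0 : (0 < n)%N.

(** The tensors in the plane are stable under the permutations of [S], so
    [young_two_rows] applies to the vector [b a h z] that detects the isotypic
    component. *)
Lemma proj_side_two_rows (S : {set 'I_k}) la w (z : T) :
    is_partition n la -> in_plane S z ->
    proj_side R d n S la (cutoff R (fun X => weight S X == w) z) != 0 ->
  exists m, [/\ la = two_rows n m, (m <= n - m)%N, (m <= w)%N & (w <= n - m)%N].
Proof.
move=> la_part z_plane.
move/(orthoproj_isotypic_neq0 (@sym_actM R k d n S)
  (@sym_act_adj R k d n S)) => [h].
set Q : pred {ffun 'I_n -> idx d} := (fun X => weight S X == w).
set y := col_sym _ _ _.
have cut_act g (x : T) : act S g (cutoff R Q x) = cutoff R Q (act S g x).
  by apply: sym_act_cutoff => X; rewrite /Q weight_perm.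
have yE : y = cutoff R Q (col_sym (act S) la (row_sym (act S) la (act S h z))).
  have cut_row (x : T) : row_sym (act S) la (cutoff R Q x) =
      cutoff R Q (row_sym (act S) la x).
    by rewrite /row_sym [in RHS]linear_sum /=; apply: eq_bigr => p _; apply: cut_act.
  rewrite /y cut_act cut_row /col_sym [in RHS]linear_sum /=; apply: eq_bigr => q _.
  by rewrite linearZ /= cut_act.
move=> y0; have [X yX] : exists X, y X != 0.
  apply/existsP; apply: contraR y0 => /existsPn y0.
  by apply/eqP/ffunP => X; rewrite ffunE; apply/eqP/negPn/y0.
have yQ : weight S X = w.
  by move: yX; rewrite yE cutoffE; case: ifP => [/eqP //|_]; rewrite eqxx.
have y_plane : in_plane S y.
  apply: in_plane_sum => q; apply: in_plane_act.
  rewrite /row_sym; under eq_bigr => p _ do rewrite -[act S p _]scale1r.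
  apply: in_plane_sum => p; do 2 apply: in_plane_act.
  by apply: in_plane_cutoff => // X' Y' XY; rewrite /Q /weight; under eq_bigr do rewrite XY.
have y_anti q : q \in col_stab n la -> act S q y = ((-1) ^+ odd_perm q : C) *: y.
  exact: (col_sym_anti (@sym_actM R k d n S)).
by have := young_two_rows la_part n_gt0 y_plane y_anti yX; rewrite yQ.
Qed.

Variable psi : tensor R d.
Hypothesis psiE : forall x, psi x = (exc [set: 'I_k] x == 1%N)%:R.

Lemma tpow_neq0 (X : {ffun 'I_n -> idx d}) m :
  tpow n psi X != 0 -> exc [set: 'I_k] (X m) = 1%N.
Proof.
rewrite ffunE => /prodf_neq0 /(_ m isT); rewrite psiE.
by apply: contraNeq => /negPf ->.
Qed.

Lemma tpow_in_plane S : in_plane S (tpow n psi).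
Proof.
split=> [X Y out inn|X m]; last first.
  by move/(@tpow_neq0 _ m); rewrite (excC S); lia.
rewrite !ffunE; apply: eq_bigr => m _; rewrite !psiE !(excC S) inn.
rewrite (_ : exc (~: S) (X m) = exc (~: S) (Y m)) //.
by apply: eq_bigr => i; rewrite inE => iS; rewrite out.
Qed.

(** The weights of any word at which the projected tensor does not vanish give
    the counts [w]: weight projections commute with all the projectors. *)
Lemma proj_family_neq0_weights (theta : bipartition k -> R)
    (la : bipartition k -> seq nat) :
    (forall b b', theta b != 0 -> theta b' != 0 -> compatible (side b) (side b')) ->
    (forall b, theta b != 0 -> is_partition n (la b)) ->
    proj_family d n theta la (tpow n psi) != 0 ->
  exists2 w : 'I_k -> nat, \sum_j w j = n & forall b, theta b != 0 ->
    exists m, [/\ la b = two_rows n m, (m <= n - m)%N,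
      (m <= \sum_(j in side b) w j)%N & (\sum_(j in side b) w j <= n - m)%N].
Proof.
move=> compat la_part nz.
have [X] : exists X, proj_family d n theta la (tpow n psi) X != 0.
  apply/existsP; apply: contraR nz => /existsPn y0.
  by apply/eqP/ffunP => X; rewrite ffunE; apply/eqP/negPn/y0.
pose w j := (\sum_(m < n) X m j)%N.
pose Q (S : {set 'I_k}) (Y : {ffun 'I_n -> idx d}) := weight S Y == weight S X.
have cutX S f : cutoff R (Q S) f X = f X by rewrite cutoffE /Q eqxx.
have cutC S f : cutoff R (Q S) (proj_family d n theta la f) =
    proj_family d n theta la (cutoff R (Q S) f).
  apply: big_comp_comm => b _ f'; apply/esym; apply: proj_bip_cutoff.
  by move=> S' g Y; rewrite /Q weight_perm.
have weightX S : weight S X = (\sum_(j in S) w j)%N by rewrite weightE.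
move=> nzX; exists w => [|b thb].
  have : cutoff R (Q [set: 'I_k]) (tpow n psi) != 0.
    apply: contraNneq nzX => E; rewrite -(cutX [set: 'I_k]) cutC E linear0.
    by rewrite ffunE.
  move=> c0; have [Y] : exists Y, cutoff R (Q [set: 'I_k]) (tpow n psi) Y != 0.
    apply/existsP; apply: contraR c0 => /existsPn y0.
    by apply/eqP/ffunP => Y; rewrite ffunE; apply/eqP/negPn/y0.
  rewrite cutoffE /Q; case: ifP => [/eqP|_]; last by rewrite eqxx.
  rewrite weightX (eq_bigl xpredT) => [<- Y0|j]; last by rewrite inE.
  rewrite /weight (eq_bigr (fun=> 1%N)) ?sum1_card ?card_ord // => m _.
  exact: tpow_neq0.
rewrite -weightX; apply: (proj_side_two_rows (la_part b thb) (tpow_in_plane _)).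
apply: contraNneq nzX => E; rewrite -(cutX (side b)) cutC.
suff -> : proj_family d n theta la (cutoff R (Q (side b)) (tpow n psi)) = 0.
  by rewrite ffunE.
apply: (@big_comp_eq0 _ _ _ (fun b => proj_bip R d n b (la b)) b _
  (fun b => theta b != 0)); [exact: mem_index_enum | exact: thb | |].
  by move=> b' thb' f; apply: proj_bip_comm; apply: compat.
rewrite proj_bip_invariant; first exact: E.
apply: cutoff_invariant => [g Y|].
  by rewrite /Q weight_perm.
exact: tpow_invariant.
Qed.
End Obstruction.

(** * Two-row tableaux and products of singlets *)

Section TwoRowTableau.
Variables (n m : nat).
Hypothesis mn : (m <= n - m)%N.
Local Notation la := (two_rows n m).

Lemma flatten_two_rows (i : 'I_n) :
  exists r c, [/\ (c < nth 0 la r)%N, i = flatten_index la r c :> nat,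
    r = ~~ (i < n - m)%N & c = (if (i < n - m)%N then i : nat else i - (n - m))%N].
Proof.
have := ltn_ord i; rewrite /two_rows; case: (posnP m) => [->|m0] i_n.
  by exists 0%N, i; rewrite subn0 i_n.
case: ltnP => [ilt|ige].
  by exists 0%N, i; rewrite /flatten_index take0.
by exists 1%N, (i - (n - m))%N; rewrite /flatten_index /= addn0; split=> //; lia.
Qed.

Lemma index_two_rows (i : 'I_n) :
  reshape_index la i = ~~ (i < n - m)%N.
Proof.
by have [r [c [h -> <- _]]] := flatten_two_rows i; rewrite flatten_indexKl.
Qed.

Lemma offset_two_rows (i : 'I_n) :
  reshape_offset la i = (if (i < n - m)%N then i : nat else i - (n - m))%N.
Proof.
by have [r [c [h -> _ <-]]] := flatten_two_rows i; rewrite flatten_indexKr.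
Qed.

Lemma lower_lt (c : 'I_m) : (n - m + c < n)%N.
Proof. have := ltn_ord c; lia. Qed.

Lemma upper_lt (c : 'I_m) : (c < n)%N.
Proof. have := ltn_ord c; lia. Qed.

Definition upper (c : 'I_m) : 'I_n := Ordinal (upper_lt c).
Definition lower (c : 'I_m) : 'I_n := Ordinal (lower_lt c).

Lemma col_stab_upper q c : q \in col_stab n la ->
  q (upper c) = upper c \/ q (upper c) = lower c.
Proof.
rewrite inE => /forallP /(_ (upper c)); rewrite !offset_two_rows /=.
have -> : (c < n - m)%N by have := ltn_ord c; lia.
case: ifP => h /eqP e; [left | right]; apply: val_inj => //=.
by rewrite -e; move: h; lia.
Qed.

Lemma col_stab_fix q : q \in col_stab n la ->
  (forall c, q (upper c) = upper c) -> q = 1%g.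
Proof.
move=> qC qu; apply/permP => i; rewrite perm1; apply: val_inj => /=.
have := qC; rewrite inE => /forallP /(_ i); rewrite !offset_two_rows.
have qi := ltn_ord (q i); have ii := ltn_ord i.
case: ifP => h1; case: ifP => h2 /eqP e //.
- have cm : (i - (n - m) < m)%N by lia.
  have : q i = q (upper (Ordinal cm)) by rewrite qu; apply: val_inj.
  by move/perm_inj => /(congr1 val) /=; lia.
- have cm : (q i - (n - m) < m)%N by lia.
  have qE := qu (Ordinal cm).
  have iE : i = upper (Ordinal cm) by apply: val_inj; rewrite /= -e.
  by rewrite -iE in qE; rewrite qE.
- by move: h1 h2; lia.
Qed.

Lemma tperm_col_stab c : tperm (upper c) (lower c) \in col_stab n la.
Proof.
have e : reshape_offset la (upper c) = reshape_offset la (lower c).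
  rewrite !offset_two_rows /= [in RHS]ifF ?ifT; last by lia.
    by rewrite addKn.
  by have := ltn_ord c; lia.
rewrite inE; apply/forallP => i.
by case: tpermP => [->|->|_ _]; rewrite ?e.
Qed.

Lemma upper_lower c c' : upper c != lower c'.
Proof. by rewrite -val_eqE /=; have := ltn_ord c; lia. Qed.

(** The column group is generated by the transpositions of the columns of length
    two, by induction on the number of columns that a permutation moves. *)
Lemma col_stab_ind (P : 'S_n -> Prop) :
    P 1%g -> (forall c q, q \in col_stab n la -> P q ->
                P (tperm (upper c) (lower c) * q)%g) ->
  forall q, q \in col_stab n la -> P q.
Proof.
move=> P1 PM q; have [s] := ubnP #|[set c | q (upper c) != upper c]|.
elim: s q => [//|s IH] q hs qC.
have [/eqP|[c]] := set_0Vmem [set c | q (upper c) != upper c].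
  rewrite -finset.subset0 => /fintype.subsetP q0.
  rewrite (col_stab_fix qC) // => c; apply/eqP/negPn/negP => qc.
  by have := q0 c; rewrite !inE qc => /(_ isT).
rewrite inE => qc; pose t := tperm (upper c) (lower c).
have {1}-> : q = (t * (t * q))%g by rewrite mulgA /t tperm2 mul1g.
have tqC : (t * q)%g \in col_stab n la by rewrite col_stabM ?tperm_col_stab.
apply: PM => //; apply: IH => //; rewrite ltnS in hs.
apply: leq_trans hs; apply: proper_card; apply/properP; split.
  apply/fintype.subsetP => c'; rewrite !inE permM /t.
  case: tpermP => [/(congr1 val)/= cc|/eqP|//].
    by have -> : c' = c by apply: val_inj.
  by rewrite (negPf (upper_lower _ _)).
exists c; rewrite inE // permM tpermL negbK.
have [e|e] := col_stab_upper c qC; first by rewrite e eqxx in qc.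
have : reshape_offset la (q (lower c)) = c.
  move: qC; rewrite inE => /forallP/(_ (lower c)) /eqP ->.
  by rewrite offset_two_rows /= ifF ?addKn //; lia.
rewrite offset_two_rows; case: ifP => [_ qE|h qE].
  by apply/eqP/val_inj.
have : q (lower c) = q (upper c) by rewrite e; apply: val_inj => /=; lia.
by move/perm_inj/eqP; rewrite eq_sym (negPf (upper_lower _ _)).
Qed.

End TwoRowTableau.

Section Criterion.
Variables (R : realType) (k n m : nat).
Local Notation C := R[i].
Local Notation d := (fun _ : 'I_k => 2%N).
Local Notation word := {ffun 'I_n -> idx d}.
Local Notation T := (ptensor R d n).
Hypothesis mn : (m <= n - m)%N.
Local Notation la := (two_rows n m).
Local Notation up := (upper mn).
Local Notation low := (lower mn).
Variable S : {set 'I_k}.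
Local Notation act := (@sym_act R k d n S).
Let act1 := @sym_act1 R k d n S.
Let actM := @sym_actM R k d n S.
Let act_adj := @sym_act_adj R k d n S.
Local Notation iso := (isotypic act la).

Variable v : T.
Hypothesis v_anti : forall c, act (tperm (up c) (low c)) v = - v.
Hypothesis v_supp : forall X c, v X != 0 ->
  (exc S (X (up c)) == 0%N) != (exc S (X (low c)) == 0%N).
Let Q (X : word) := [forall c, exc S (X (up c)) == 0%N].
Hypothesis v_row : forall g, g \in row_stab n la ->
  act g (cutoff R Q v) = cutoff R Q v.

Lemma anti_col_stab (t : T) :
  (forall c, act (tperm (up c) (low c)) t = - t) ->
  forall q, q \in col_stab n la -> act q t = ((-1) ^+ odd_perm q : C) *: t.
Proof.
move=> t_anti; apply: (@col_stab_ind _ _ mn) => [|c q qC IH].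
  by rewrite act1 odd_perm1 expr0 scale1r.
rewrite actM t_anti linearN /= IH odd_permM odd_tperm upper_lower.
by rewrite signr_addb expr1 mulN1r scaleNr.
Qed.

(** Each column transposition matches the words in the support of [f] whose upper
    box is excited with those whose upper box is not. *)
Lemma sum_halves (f : word -> C) (s : seq 'I_m) :
    uniq s ->
    (forall X c, f (perm_idx S (tperm (up c) (low c)) X) = f X) ->
    (forall X c, f X != 0 ->
       (exc S (X (up c)) == 0%N) != (exc S (X (low c)) == 0%N)) ->
  \sum_X f X = (\sum_(X : word | all (fun c => exc S (X (up c)) == 0%N) s) f X) *+ 2 ^ size s.
Proof.
move=> + f_inv f_supp; elim: s => [_|c s IH /= /andP[cs us]]; first by [].
rewrite IH // expnS mulrnA; congr (_ *+ _).
rewrite (bigID (fun X : word => exc S (X (up c)) == 0%N)) /= mulr2n.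
congr (_ + _); first by apply: eq_bigl => X; rewrite andbC.
rewrite (reindex_inj (can_inj (perm_idxK S (tperm (up c) (low c))))) /=.
rewrite big_mkcond [RHS]big_mkcond /=; apply: eq_bigr => X _.
rewrite f_inv !exc_perm // tpermL.
have [->|fX] := eqVneq (f X) 0; first by rewrite !if_same.
have -> : all (fun c' => exc S (perm_idx S (tperm (up c) (low c)) X (up c')) == 0%N) s
    = all (fun c' => exc S (X (up c')) == 0%N) s.
  apply: eq_in_all => c' c's; rewrite exc_perm // tpermD //.
    by apply: contraNneq cs => /(congr1 val) /= e; have -> : c = c' by apply: val_inj.
  by rewrite eq_sym upper_lower.
have -> : (exc S (X (low c)) == 0%N) = ~~ (exc S (X (up c)) == 0%N).
  by move: (f_supp X c fX); do 2 case: (exc S _ == 0%N).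
by rewrite negbK andbC.
Qed.

(** The component [r] of [v] orthogonal to the isotypic space is antisymmetric
    along the columns like [v], hence [b r] is a positive multiple of [r], and
    [a b r = 0] gives [a r = 0].  So [r] is orthogonal to the row-invariant half of
    [v], hence to [v] by [sum_halves], hence to itself. *)
Lemma two_rows_criterion : v \in iso.
Proof.
pose P := orthoproj iso; pose r := v - P v.
have rU : r \in orthocompl iso by apply: orthoproj_compl.
have r_anti c : act (tperm (up c) (low c)) r = - r.
  rewrite /r linearB /= v_anti opprB addrC; congr (_ - _).
  rewrite -(orthoproj_comm (act_adj _)) ?v_anti ?linearN ?opprK //;
    by move=> u; apply: isotypic_stable.
have col_r : col_sym act la r = (#|col_stab n la|%:R : C) *: r.
  rewrite /col_sym (eq_bigr (fun=> r)) ?sumr_const ?scaler_nat // => q qC.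
  by rewrite anti_col_stab // scalerA -expr2 sqrr_sign scale1r.
have row_r : row_sym act la r = 0.
  have h : row_sym act la (col_sym act la r) = 0.
    apply: inner_ext => w; rewrite inner0l.
    rewrite (row_sym_adj act_adj) (col_sym_adj act_adj).
    by rewrite (memv_orthocompl _ _ rU) // (col_row_sym_mem act1 actM act_adj).
  move: h; rewrite col_r -[_ *: r]addr0 row_sym_linear.
  have -> : row_sym act la 0 = 0.
    by rewrite /row_sym big1 // => p _; rewrite linear0.
  rewrite addr0 => /eqP; rewrite scaler_eq0 pnatr_eq0.
  case: (posnP #|col_stab n la|) => [/eqP|_ /eqP //].
  rewrite cards_eq0 => /eqP c0; have : (1%g : 'S_n) \in col_stab n la.
    by rewrite inE; apply/forallP => i; rewrite perm1.
  by rewrite c0 inE.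
have xr : inner (cutoff R Q v) r = 0.
  have rowx : row_sym act la (cutoff R Q v) =
      (#|row_stab n la|%:R : C) *: cutoff R Q v.
    rewrite /row_sym (eq_bigr (fun=> cutoff R Q v)) ?sumr_const ?scaler_nat //.
  have : inner (row_sym act la (cutoff R Q v)) r = 0.
    by rewrite (row_sym_adj act_adj) row_r inner0r.
  rewrite rowx innerZl => /eqP; rewrite mulf_eq0 pnatr_eq0.
  case: (posnP #|row_stab n la|) => [/eqP|_ /eqP //].
  rewrite cards_eq0 => /eqP c0; have : (1%g : 'S_n) \in row_stab n la.
    by rewrite inE; apply/forallP => i; rewrite perm1.
  by rewrite c0 inE.
have vr : inner v r = 0.
  pose f X : C := v X * (r X)^*.
  have act_at (t : T) g X : t (perm_idx S g X) = act g t X.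
    by rewrite sym_actE ffunE.
  have -> : inner v r = \sum_X f X by [].
  rewrite (@sum_halves f (enum 'I_m)) ?enum_uniq //; first last.
  - move=> X c; rewrite mulf_eq0 negb_or => /andP[vX _]; exact: v_supp.
  - by move=> X c; rewrite /f !act_at v_anti r_anti !ffunE rmorphN mulrNN.
  suff -> : \sum_(X : word | all (fun c => exc S (X (up c)) == 0%N) (enum 'I_m)) f X =
      inner (cutoff R Q v) r by rewrite xr mul0rn.
  rewrite innerE big_mkcond; apply: eq_bigr => X _; rewrite cutoffE /Q.
  have -> : all (fun c => exc S (X (up c)) == 0%N) (enum 'I_m) =
      [forall c, exc S (X (up c)) == 0%N].
    by apply/allP/forallP => [h c|h c _]; apply: h; rewrite mem_enum.
  by case: ifP; rewrite ?mul0r.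
suff r0 : r = 0.
  by rewrite (subr0_eq r0) orthoproj_mem.
apply/eqP; rewrite -inner_eq0 {1}/r innerDl innerNl vr sub0r oppr_eq0 innerC.
by rewrite (memv_orthocompl _ _ rU) ?orthoproj_mem // rmorph0.
Qed.

End Criterion.

Section Pairing.
Variables (N : nat) (D : {set 'I_N}).
Local Notation n := (N + N)%N.
Local Notation m := #|D|.

Lemma card_pairs_le : (m <= n - m)%N.
Proof. by have := max_card D; rewrite card_ord; lia. Qed.

Definition second_of : {set 'I_n} := [set rshift N i | i in D].

(** A placement of the tableau on the [2N] positions that makes the chosen
    pairs the columns of length two. *)
Lemma pairing_tableau : exists s : 'S_n,
  [/\ forall c, s (upper card_pairs_le c) = lshift N (enum_val c),
      forall c, s (lower card_pairs_le c) = rshift N (enum_val c) &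
      forall i, (s i \in second_of) = ~~ (i < n - m)%N].
Proof.
pose E := enum D.
have memE i : (i \in E) = (i \in D) by rewrite mem_enum.
have [E' [uE' eC memE']] : exists E' : seq 'I_N,
    [/\ uniq E', size E' = (N - m)%N & forall i, (i \in E') = (i \notin D)].
  exists (enum (~: D)); split=> [||i]; [exact: enum_uniq | | by rewrite mem_enum inE].
  have := cardsC D; rewrite card_ord [#|~: D|]cardE => e.
  by rewrite -[X in (X - _)%N]e addKn.
pose s1 := [seq lshift N i | i <- E] ++
  ([seq lshift N i | i <- E'] ++ [seq rshift N i | i <- E']).
pose s2 := [seq rshift N i | i <- E].
have mN : (m <= N)%N by have := max_card D; rewrite card_ord.
have eD : size E = m by rewrite -cardE.
have sz1 : size s1 = (n - m)%N.
  by rewrite !size_cat !size_map eD eC; lia.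
have sz : size (s1 ++ s2) = n by rewrite size_cat sz1 size_map eD; lia.
have lr i j : lshift N i == rshift N j = false by rewrite eq_lrshift.
have us : uniq (s1 ++ s2).
  rewrite /s1 /s2 !cat_uniq.
  rewrite !(map_inj_uniq (@lshift_inj _ _)) !(map_inj_uniq (@rshift_inj _ _)).
  rewrite !enum_uniq !uE' /= !andbT -andbA; apply/and3P; split.
  - apply/hasPn => x; rewrite mem_cat => /orP[] /mapP[j]; rewrite memE' => iD ->.
      by apply/negP => /mapP[j']; rewrite memE => jD /lshift_inj ij; rewrite ij jD in iD.
    by apply/negP => /mapP[j' _] /esym/eqP; rewrite lr.
  - apply/hasPn => x /mapP[j _ ->].
    by apply/negP => /mapP[j' _] /esym/eqP; rewrite lr.
  apply/hasPn => x /mapP[j]; rewrite memE => iD ->.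
  rewrite !mem_cat !negb_or; apply/and3P; split.
  - by apply/negP => /mapP[j' _] /esym/eqP; rewrite lr.
  - by apply/negP => /mapP[j' _] /esym/eqP; rewrite lr.
  by apply/negP => /mapP[j']; rewrite memE' => jD /rshift_inj ij; rewrite -ij iD in jD.
pose f (i : 'I_n) := nth i (s1 ++ s2) i.
have f_inj : injective f.
  move=> i j; rewrite /f (set_nth_default i) ?sz // => /eqP.
  by rewrite nth_uniq ?sz // => /eqP /val_inj.
exists (perm f_inj); split=> [c|c|i]; rewrite permE /f.
- have cm := ltn_ord c.
  rewrite nth_cat sz1 ifT /=; last exact: leq_trans cm card_pairs_le.
  rewrite nth_cat size_map eD cm (nth_map (enum_val c)) ?eD //.
  by rewrite -enum_val_nth.
- rewrite nth_cat sz1 ifF /=; last by apply/negbTE; rewrite -leqNgt leq_addr.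
  rewrite addKn (nth_map (enum_val c)) ?eD //.
  by rewrite -enum_val_nth.
rewrite nth_cat sz1; case: ltnP => im.
  have : nth i s1 i \in s1 by rewrite mem_nth // sz1.
  rewrite !mem_cat => /or3P[] /mapP[j jD ->]; apply/negbTE/negP => /imsetP[j' j'D].
  - by move/eqP; rewrite lr.
  - by move/eqP; rewrite lr.
  by move/rshift_inj => e; move: jD; rewrite memE' e j'D.
have : nth i s2 (i - (n - m)) \in s2.
  by rewrite mem_nth // size_map eD; have := ltn_ord i; lia.
by case/mapP => j; rewrite memE => jD ->; apply/imsetP; exists j.
Qed.

End Pairing.

Section PairFunctions.
Variables (R : realType) (k N : nat).
Local Notation C := R[i].
Local Notation d := (fun _ : 'I_k => 2%N).
Local Notation n := (N + N)%N.
Local Notation word := {ffun 'I_n -> idx d}.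
Local Notation T := (ptensor R d n).
Implicit Types (S : {set 'I_k}) (D : {set 'I_N}) (X : word) (p q : idx d).

Definition singlet S p q : C :=
  ((exc S p == 0%N) && (exc S q == 1%N))%:R - ((exc S p == 1%N) && (exc S q == 0%N))%:R.
Definition vacuum S p q : C := ((exc S p == 0%N) && (exc S q == 0%N))%:R.

Definition pair_factor S D (i : 'I_N) X : C :=
  (if i \in D then singlet S else vacuum S) (X (lshift N i)) (X (rshift N i)).

Definition pair_state S D X : C := \prod_(i < N) pair_factor S D i X.

Lemma singletC S p q : singlet S q p = - singlet S p q.
Proof. by rewrite /singlet opprB; congr (_ - _); rewrite andbC. Qed.

Lemma singlet_neq0 S p q : singlet S p q != 0 ->
  (exc S p == 0%N) != (exc S q == 0%N) /\ (exc S p + exc S q = 1)%N.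
Proof.
rewrite /singlet; case: (exc S p) => [|[|e]]; case: (exc S q) => [|[|e']] //=;
  by rewrite ?subrr ?eqxx.
Qed.

Lemma pair_state_perm S S' D g X : [disjoint S & S'] ->
  pair_state S D (perm_idx S' g X) = pair_state S D X.
Proof.
move=> SS'; have e j : exc S (perm_idx S' g X j) = exc S (X j).
  by apply: eq_bigr => i iS; rewrite !ffunE (disjointFr SS' iS).
by apply: eq_bigr => i _; rewrite /pair_factor; case: ifP;
   rewrite /singlet /vacuum !e.
Qed.

Lemma pair_state_swap S D X i : i \in D ->
  pair_state S D (perm_idx S (tperm (lshift N i) (rshift N i)) X) =
  - pair_state S D X.
Proof.
move=> iD; rewrite /pair_state (bigD1 i) //= [in RHS](bigD1 i) //= -mulNr.
have e j : exc S (perm_idx S (tperm (lshift N i) (rshift N i)) X j) =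
    exc S (X (tperm (lshift N i) (rshift N i) j)) by apply: exc_perm.
congr (_ * _).
  by rewrite /pair_factor iD -singletC /singlet !e tpermL tpermR.
apply: eq_bigr => j ji.
have [nl nr] : lshift N i != lshift N j /\ rshift N i != rshift N j.
  by rewrite eq_lshift eq_rshift eq_sym ji.
by rewrite /pair_factor; case: ifP;
  rewrite /singlet /vacuum !e !tpermD ?eq_lrshift ?eq_rlshift.
Qed.

Lemma pair_state_neq0 S D X i : pair_state S D X != 0 ->
  if i \in D then (exc S (X (lshift N i)) == 0%N) != (exc S (X (rshift N i)) == 0%N)
             /\ (exc S (X (lshift N i)) + exc S (X (rshift N i)) = 1)%N
  else (exc S (X (lshift N i)) = 0)%N /\ (exc S (X (rshift N i)) = 0)%N.
Proof.
move/prodf_neq0 => /(_ i isT); rewrite /pair_factor; case: ifP => _.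
  exact: singlet_neq0.
by rewrite /vacuum pnatr_eq0 eqb0 negbK => /andP[/eqP -> /eqP ->].
Qed.

Lemma pair_state_weight S D X : pair_state S D X != 0 -> weight S X = #|D|.
Proof.
move=> nz; rewrite /weight big_split_ord /= -big_split /= -sum1_card.
rewrite [RHS]big_mkcond; apply: eq_bigr => i _ /=.
by have := pair_state_neq0 i nz; case: ifP => _ [] // -> ->.
Qed.

(** Keeping the half of the singlets whose first position is unexcited leaves a
    single pattern of excitations, which depends on the set of second positions
    only and is therefore invariant under the rows. *)
Lemma pair_state_half S D X :
  pair_state S D X * [forall i in D, exc S (X (lshift N i)) == 0%N]%:R =
  [forall j, exc S (X j) == (j \in second_of D)]%:R.
Proof.
have second i : (rshift N i \in second_of D) = (i \in D).
  by rewrite mem_imset //; apply: rshift_inj.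
have first i : (lshift N i \in second_of D) = false.
  by apply/negbTE/negP => /imsetP[j _] /eqP; rewrite eq_lrshift.
case: forallP => [h|h].
  have -> : [forall i in D, exc S (X (lshift N i)) == 0%N].
    by apply/forall_inP => i _; rewrite (eqP (h _)) first.
  rewrite mulr1; apply: big1 => i _; rewrite /pair_factor /singlet /vacuum.
  by case: ifP => iD; rewrite !(eqP (h _)) first second iD /= ?subr0.
have [half|] := boolP [forall i in D, exc S (X (lshift N i)) == 0%N]; last first.
  by rewrite mulr0.
rewrite mulr1; apply/eqP/negPn/negP => nz; apply: h => j.
case: (split_ordP j) => i ->; rewrite ?first ?second;
  have := pair_state_neq0 i nz; case: ifP => iD [].
- by rewrite (forall_inP half _ iD).
- by move=> ->.
- by rewrite (eqP (forall_inP half _ iD)) => _; rewrite add0n => ->.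
- by move=> _ ->.
Qed.

(** Each singlet is antisymmetric and fills a column of length two; the unexcited
    positions complete the first row.  The factor [h] stands for the state of the
    other legs. *)
Lemma pair_state_isotypic S D (h : word -> C) :
    (forall g X, h (perm_idx S g X) = h X) ->
  [ffun X => pair_state S D X * h X] \in
    isotypic (@sym_act R k d n S) (two_rows n #|D|).
Proof.
move=> h_inv; set v : T := [ffun X => _].
have [s [s_up s_low s_second]] := pairing_tableau D.
have act_at (t : T) g X : sym_act R d S g t X = t (perm_idx S g X).
  by rewrite sym_actE ffunE.
suff : sym_act R d S s^-1 v \in isotypic (@sym_act R k d n S) (two_rows n #|D|).
  move=> /(isotypic_stable (@sym_act1 R k d n S) (@sym_actM R k d n S) s).
  by rewrite -sym_actM mulVg sym_act1.
have supp X i : v X != 0 -> i \in D ->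
    (exc S (X (lshift N i)) == 0%N) != (exc S (X (rshift N i)) == 0%N).
  rewrite ffunE mulf_eq0 negb_or => /andP[/(@pair_state_neq0 _ _ _ i)] + _ iD.
  by rewrite iD => -[].
have anti X i : i \in D ->
    v (perm_idx S (tperm (lshift N i) (rshift N i)) X) = - v X.
  by move=> iD; rewrite !ffunE pair_state_swap // h_inv mulNr.
apply: (two_rows_criterion (mn := card_pairs_le D)).
- move=> c; rewrite -sym_actM.
  have -> : (s^-1 * tperm (upper (card_pairs_le D) c) (lower (card_pairs_le D) c) =
     tperm (lshift N (enum_val c)) (rshift N (enum_val c)) * s^-1)%g.
    by rewrite conjgCV invgK tpermJ s_up s_low.
  rewrite sym_actM -linearN; congr (sym_act R d S _ _); apply/ffunP => X.
  by rewrite act_at anti ?enum_valP // [RHS]ffunE.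
- move=> X c; rewrite act_at => /supp /(_ (enum_valP c)).
  by rewrite !exc_perm // -s_up -s_low !permK.
pose B (Y : word) := [forall j, exc S (Y j) == (j \in second_of D)].
have cutE X : cutoff R (fun X : word =>
      [forall c, exc S (X (upper (card_pairs_le D) c)) == 0%N])
      (sym_act R d S s^-1 v) X =
    (B (perm_idx S s^-1 X))%:R * h X.
  rewrite cutoffE act_at ffunE h_inv /B -pair_state_half.
  have -> : [forall i in D, exc S (perm_idx S s^-1 X (lshift N i)) == 0%N] =
      [forall c, exc S (X (upper (card_pairs_le D) c)) == 0%N].
    apply/forall_inP/forallP => [h' c|h' i iD].
      by have := h' _ (enum_valP c); rewrite exc_perm // -s_up permK.
    rewrite exc_perm // -(enum_rankK_in iD iD) -s_up permK; exact: h'.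
  by case: ifP; rewrite ?mulr1 ?mulr0 ?mul0r.
move=> g gR; apply/ffunP => X; rewrite act_at !cutE h_inv; congr (_%:R * _).
have sg j : (s (g (s^-1%g j)) \in second_of D) = (j \in second_of D).
  rewrite s_second -[in RHS](permKV s j) s_second.
  move: gR; rewrite inE => /forallP /(_ (s^-1%g j)).
  rewrite !index_two_rows ?card_pairs_le // => /eqP.
  by do 2 case: (_ < _)%N.
have exc_g j : exc S (perm_idx S s^-1 (perm_idx S g X) j) =
    exc S (perm_idx S s^-1 X (s (g (s^-1%g j)))).
  by rewrite !exc_perm // permK.
congr (nat_of_bool _); apply/forallP/forallP => H j.
  have := H (s (g^-1%g (s^-1%g j))).
  by rewrite exc_g !(permK, permKV) -sg !(permK, permKV).
by rewrite exc_g -sg; apply: H.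
Qed.

(** A singlet of the block is the sum of a singlet on [S1] and a singlet on [S2];
    the number of excitations on [S1] tells how many pairs choose [S1]. *)
Lemma pair_state_split S S1 S2 D X a :
    S = S1 :|: S2 -> [disjoint S1 & S2] ->
  pair_state S D X * (weight S1 X == a)%:R =
  \sum_(E : {set 'I_N} | (E \subset D) && (#|E| == a))
    pair_state S1 E X * pair_state S2 (D :\: E) X.
Proof.
move=> SE S12.
have excE x : exc S x = (exc S1 x + exc S2 x)%N.
  rewrite /exc SE -bigU //; apply: eq_bigl => i; by rewrite inE.
pose F i := if i \in D then singlet S1 (X (lshift N i)) (X (rshift N i)) *
  vacuum S2 (X (lshift N i)) (X (rshift N i)) else 0.
pose G i := if i \in D then vacuum S1 (X (lshift N i)) (X (rshift N i)) *
  singlet S2 (X (lshift N i)) (X (rshift N i)) else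
  vacuum S1 (X (lshift N i)) (X (rshift N i)) *
  vacuum S2 (X (lshift N i)) (X (rshift N i)).
have -> : pair_state S D X = \prod_i (F i + G i).
  apply: eq_bigr => i _; rewrite /pair_factor /F /G; case: ifP => _;
    rewrite /singlet /vacuum !excE;
    case: (exc S1 (X (lshift N i))) => [|[|e1]];
    case: (exc S2 (X (lshift N i))) => [|[|e2]];
    case: (exc S1 (X (rshift N i))) => [|[|e3]];
    case: (exc S2 (X (rshift N i))) => [|[|e4]]; rewrite /=; ring.
rewrite bigA_distr mulr_suml (bigID (fun E : {set 'I_N} => E \subset D)) /=.
rewrite [X in _ + X]big1 ?addr0; last first.
  move=> E /fintype.subsetPn[j iE iD].
  by rewrite (bigD1 j) //= iE /F (negPf iD) !mul0r.
rewrite [RHS]big_mkcondr; apply: eq_bigr => E ED.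
have -> : \prod_i (if i \in E then F i else G i) =
    pair_state S1 E X * pair_state S2 (D :\: E) X.
  rewrite /pair_state -big_split; apply: eq_bigr => i _; rewrite /F /G.
  rewrite /pair_factor inE; case: ifP => iE /=; last by case: ifP.
  by rewrite (fintype.subsetP ED).
have [->|nz] := eqVneq (pair_state S1 E X) 0.
  by rewrite !mul0r if_same.
by rewrite (pair_state_weight nz); case: eqP; rewrite ?mulr1 ?mulr0.
Qed.

End PairFunctions.

(** * A vector detecting given excitation numbers *)

Section Witness.
Variables (R : realType) (k N : nat).
Local Notation C := R[i].
Local Notation d := (fun _ : 'I_k => 2%N).
Local Notation n := (N + N)%N.
Local Notation word := {ffun 'I_n -> idx d}.
Local Notation T := (ptensor R d n).
Variables (j1 j2 j3 j4 : 'I_k) (w1 w2 w3 w4 : nat).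
Hypothesis legs_uniq : uniq [:: j1; j2; j3; j4].
Hypothesis legs_all : forall j, j \in [:: j1; j2; j3; j4].
Hypothesis w12 : (w1 + w2 <= N)%N.
Hypothesis w3N : (w3 <= N)%N.
Hypothesis w4N : (w4 <= N)%N.
Hypothesis w_sum : (w1 + w2 + w3 + w4 = n)%N.

Let S12 := [set j1; j2].
Let D12 := [set i : 'I_N | (i < w1 + w2)%N].
Let D3 := [set i : 'I_N | (i < N - w4)%N || (w1 + w2 <= i)%N].
Let D4 := [set i : 'I_N | (N - w4 <= i)%N].

(** Two of the three blocks [{j1, j2}], [j3], [j4] carry a singlet at each of the
    [N] pairs of positions, and the third one carries the vacuum.  The sets [D12],
    [D3], [D4] of pairs are chosen such that they have [w1 + w2], [w3] and [w4]
    elements.  The remaining condition fixes how many of the singlets of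
    [{j1, j2}] sit on [j1]. *)
Definition witness : T := [ffun X : word => pair_state R S12 D12 X *
  ((weight [set j1] X == w1)%:R *
   (pair_state R [set j3] D3 X * pair_state R [set j4] D4 X))].

Lemma card_lt a : (a <= N)%N -> #|[set i : 'I_N | (i < a)%N]| = a.
Proof.
move=> aN; rewrite -sum1_card; under eq_bigl do rewrite inE.
by rewrite -(big_ord_widen _ (fun=> 1%N) aN) sum1_card card_ord.
Qed.

Lemma card_D12 : #|D12| = (w1 + w2)%N.
Proof. exact: card_lt. Qed.

Lemma card_D4 : #|D4| = w4.
Proof.
have -> : D4 = ~: [set i : 'I_N | (i < N - w4)%N].
  by apply/setP => i; rewrite !inE -leqNgt.
have := cardsC [set i : 'I_N | (i < N - w4)%N].
by rewrite card_lt ?leq_subr // card_ord; lia.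
Qed.

Lemma card_D3 : #|D3| = w3.
Proof.
have e : ~: D3 = D12 :\: [set i : 'I_N | (i < N - w4)%N].
  by apply/setP => i; rewrite !inE; lia.
have := cardsC D3; rewrite e cardsD (finset.setIidPr _) ?card_D12; last first.
  by apply/fintype.subsetP => i; rewrite !inE; lia.
rewrite card_lt ?leq_subr // card_ord; lia.
Qed.

Lemma legs_neq : [/\ j1 != j2, j1 != j3, j1 != j4, j2 != j3 & j2 != j4] /\ j3 != j4.
Proof.
by move: legs_uniq; rewrite /= !inE !negb_or -!andbA => /and5P[-> -> -> ->] /and3P[-> ->].
Qed.

Lemma disjoint1 (i j : 'I_k) : i != j -> [disjoint [set i] & [set j]].
Proof. by move=> ij; rewrite disjoints1 inE. Qed.

Lemma witness_isotypic12 :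
  witness \in isotypic (@sym_act R k d n S12) (two_rows n (w1 + w2)).
Proof.
have [[_ n13 n14 n23 n24] _] := legs_neq.
rewrite -card_D12; apply: pair_state_isotypic => g X.
rewrite weight_perm !pair_state_perm //; rewrite disjoints1 !inE.
  by rewrite negb_or !(eq_sym j4) n14.
by rewrite negb_or !(eq_sym j3) n13.
Qed.

Lemma witness_isotypic3 :
  witness \in isotypic (@sym_act R k d n [set j3]) (two_rows n w3).
Proof.
have [[_ n13 n14 n23 n24] n34] := legs_neq.
have -> : witness = [ffun X : word => pair_state R [set j3] D3 X *
    (pair_state R S12 D12 X * (weight [set j1] X == w1)%:R *
       pair_state R [set j4] D4 X)].
  by apply/ffunP => X; rewrite !ffunE; ring.
rewrite -card_D3; apply: pair_state_isotypic => g X.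
rewrite weight_perm !pair_state_perm //.
  by rewrite disjoint1 // eq_sym.
by rewrite disjoint_sym disjoints1 !inE negb_or !(eq_sym j3) n13.
Qed.

Lemma witness_isotypic4 :
  witness \in isotypic (@sym_act R k d n [set j4]) (two_rows n w4).
Proof.
have [[_ n13 n14 n23 n24] n34] := legs_neq.
have -> : witness = [ffun X : word => pair_state R [set j4] D4 X *
    (pair_state R S12 D12 X * (weight [set j1] X == w1)%:R *
       pair_state R [set j3] D3 X)].
  by apply/ffunP => X; rewrite !ffunE; ring.
rewrite -card_D4; apply: pair_state_isotypic => g X.
rewrite weight_perm !pair_state_perm //.
  by rewrite disjoint1.
by rewrite disjoint_sym disjoints1 !inE negb_or !(eq_sym j4) n14.
Qed.

Lemma witness_split : witness =
  \sum_(E : {set 'I_N} | (E \subset D12) && (#|E| == w1))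
    [ffun X : word => pair_state R [set j1] E X * pair_state R [set j2] (D12 :\: E) X *
      (pair_state R [set j3] D3 X * pair_state R [set j4] D4 X)].
Proof.
apply/ffunP => X; rewrite ffunE sum_ffunE mulrA.
rewrite (@pair_state_split R k N S12 [set j1] [set j2]) //; last first.
  by have [[n12 _ _ _ _] _] := legs_neq; apply: disjoint1.
by rewrite mulr_suml; apply: eq_bigr => E _; rewrite ffunE.
Qed.

(** Each summand of [witness_split] is a product of singlets on [j1], at as many
    pairs as required, and of factors on the other legs. *)
Lemma witness_isotypic1 :
  witness \in isotypic (@sym_act R k d n [set j1]) (two_rows n w1).
Proof.
have [[n12 n13 n14 n23 n24] n34] := legs_neq.
rewrite witness_split; apply: rpred_sum => E /andP[_ /eqP Ew].
have -> : [ffun X : word => pair_state R [set j1] E X *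
    pair_state R [set j2] (D12 :\: E) X *
    (pair_state R [set j3] D3 X * pair_state R [set j4] D4 X)] =
  [ffun X : word => pair_state R [set j1] E X *
    (pair_state R [set j2] (D12 :\: E) X *
    (pair_state R [set j3] D3 X * pair_state R [set j4] D4 X))].
  by apply/ffunP => X; rewrite !ffunE -mulrA.
rewrite -Ew; apply: pair_state_isotypic => g X.
by rewrite !pair_state_perm // disjoint1 // eq_sym.
Qed.

Lemma witness_isotypic2 :
  witness \in isotypic (@sym_act R k d n [set j2]) (two_rows n w2).
Proof.
have [[n12 n13 n14 n23 n24] n34] := legs_neq.
rewrite witness_split; apply: rpred_sum => E /andP[ED /eqP Ew].
have -> : [ffun X : word => pair_state R [set j1] E X *
    pair_state R [set j2] (D12 :\: E) X *
    (pair_state R [set j3] D3 X * pair_state R [set j4] D4 X)] =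
  [ffun X : word => pair_state R [set j2] (D12 :\: E) X *
    (pair_state R [set j1] E X *
    (pair_state R [set j3] D3 X * pair_state R [set j4] D4 X))].
  by apply/ffunP => X; rewrite !ffunE; ring.
have <- : #|D12 :\: E| = w2.
  by rewrite cardsD (finset.setIidPr ED) card_D12 Ew addKn.
apply: pair_state_isotypic => g X.
by rewrite !pair_state_perm // disjoint1 // eq_sym.
Qed.

Lemma exc1 j (x : idx d) : exc [set j] x = x j.
Proof. by rewrite /exc big_set1. Qed.

Lemma exc_legs (x : idx d) :
  exc [set: 'I_k] x = (exc S12 x + exc [set j3] x + exc [set j4] x)%N.
Proof.
have [[n12 n13 n14 n23 n24] n34] := legs_neq.
rewrite !exc1 /exc (@big_setU1 _ _ _ _ j1) ?inE //= big_set1.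
rewrite (eq_bigl (mem [:: j1; j2; j3; j4])) => [|j]; last by rewrite inE; apply/esym/legs_all.
by rewrite -big_uniq //= !big_cons big_nil addn0 !addnA.
Qed.

Definition excited (j : 'I_k) : idx d :=
  [ffun i => if i == j then ord_max else ord0].

Lemma exc_excited S j : exc S (excited j) = (j \in S).
Proof.
rewrite /exc; have [jS|jS] := boolP (j \in S).
  rewrite (bigD1 j) //= big1 => [|i /andP[_ /negPf ij]]; rewrite ffunE ?ij //.
  by rewrite eqxx.
apply: big1 => i iS; rewrite ffunE; case: eqP => // ij.
by rewrite ij (negPf jS) in iS.
Qed.

Variable psi : tensor R d.
Hypothesis psiE : forall x, psi x = (exc [set: 'I_k] x == 1%N)%:R.

Let g i X : C := pair_factor R S12 D12 i X * (pair_factor R [set j3] D3 i X *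
  pair_factor R [set j4] D4 i X) * (psi (X (lshift N i)) * psi (X (rshift N i))).

Lemma signed_witness X : (-1) ^+ N * (witness X * (tpow n psi X)^*) =
  (weight [set j1] X == w1)%:R * \prod_i (- g i X).
Proof.
have -> : (tpow n psi X)^* = \prod_(i < N) (psi (X (lshift N i)) * psi (X (rshift N i))).
  rewrite ffunE big_split_ord /= -big_split rmorph_prod.
  by apply: eq_bigr => i _ /=; rewrite !psiE -natrM rmorph_nat.
rewrite prodrN card_ord ffunE /pair_state /g !big_split /=; ring.
Qed.

(** If both positions of a pair carry one excitation in total, the two singlets of
    the pair are traversed in opposite directions, and the product of their signs
    is [-1].  So no cancellation occurs in the pairing with the power of [psi]. *)
Lemma pair_sign i X : 0 <= - g i X.
Proof.
rewrite /g !psiE; set p := X _; set q := X _.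
have : ((i \in D12) + (i \in D3) + (i \in D4) = 2)%N by rewrite !inE; lia.
rewrite /pair_factor -/p -/q.
have [pe|_] := eqVneq (exc [set: 'I_k] p) 1%N; last by rewrite mul0r mulr0 oppr0.
have [qe|_] := eqVneq (exc [set: 'I_k] q) 1%N; last by rewrite !mulr0 oppr0.
move: pe qe; rewrite !exc_legs mulr1 mulr1.
case: (i \in D12); case: (i \in D3); case: (i \in D4) => //=;
  rewrite /singlet /vacuum;
  case: (exc S12 p) => [|[|a1]]; case: (exc [set j3] p) => [|[|a3]];
  case: (exc [set j4] p) => [|[|a4]] //= _;
  case: (exc S12 q) => [|[|b1]]; case: (exc [set j3] q) => [|[|b3]];
  case: (exc [set j4] q) => [|[|b4]] //= _ _;
  rewrite !(subr0, sub0r, mulr0, mul0r, mul1r, mulr1, mulrN1, mulN1r, opprK, oppr0) ?ler01 //.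
Qed.

Lemma witness_tpow_neq0 : inner witness (tpow n psi) != 0.
Proof.
have [[n12 n13 n14 n23 n24] n34] := legs_neq.
suff : 0 < (-1) ^+ N * inner witness (tpow n psi).
  by apply: contraTneq => ->; rewrite mulr0 ltxx.
rewrite innerE mulr_sumr.
(* At every pair, one position excites one of the two blocks that carry singlets
   and the other position excites the other one. *)
pose X0 : word := [ffun m => match split m with
  | inl i => if (i < w1 + w2)%N then
      if (i < N - w4)%N then excited j3 else excited j4 else excited j4
  | inr i => if (i < w1)%N then excited j1 else
      if (i < w1 + w2)%N then excited j2 else excited j3 end].
have Xl i : X0 (lshift N i) = if (i < w1 + w2)%N then
      if (i < N - w4)%N then excited j3 else excited j4 else excited j4.
  by rewrite ffunE -[lshift N i]/(unsplit (inl i)) unsplitK.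
have Xr i : X0 (rshift N i) = if (i < w1)%N then excited j1 else
      if (i < w1 + w2)%N then excited j2 else excited j3.
  by rewrite ffunE -[rshift N i]/(unsplit (inr i)) unsplitK.
have pos X : 0 <= (-1) ^+ N * (witness X * (tpow n psi X)^*).
  rewrite signed_witness mulr_ge0 ?ler0n // prodr_ge0 // => i _.
  exact: pair_sign.
rewrite (bigD1 X0) //= ltr_wpDr ?sumr_ge0 // signed_witness.
have -> : weight [set j1] X0 = w1.
  rewrite /weight big_split_ord /= big1 => [|i _]; last first.
    by rewrite Xl; do ?case: ifP => _; rewrite exc_excited inE eq_sym ?(negPf n13) ?(negPf n14).
  rewrite add0n -[RHS](card_lt (a := w1)); last by move: w12; lia.
  rewrite -sum1_card [RHS]big_mkcond; apply: eq_bigr => i _ /=.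
  rewrite inE Xr; case: ifP => _; first by rewrite exc_excited inE eqxx.
  by case: ifP => _; rewrite exc_excited inE eq_sym ?(negPf n12) ?(negPf n13).
rewrite eqxx mul1r prodr_gt0 // => i _.
suff -> : g i X0 = -1 by rewrite opprK ltr01.
have inS12 j : (j \in S12) = (j == j1) || (j == j2) by rewrite !inE.
have eqs : [/\ j1 == j1, j2 == j2, j3 == j3 & j4 == j4] by rewrite !eqxx.
rewrite /g !psiE /pair_factor 3!inE Xl Xr.
case: (ltnP i w1) => h1; case: (ltnP i (w1 + w2)) => h2;
  case: (ltnP i (N - w4)) => h3 /=; try by [exfalso; lia].
all: rewrite /singlet /vacuum !exc_excited !inS12 ?finset.in_set1 ?finset.in_setT !eqxx.
all: rewrite ?[j2 == j1]eq_sym ?[j3 == _]eq_sym ?[j4 == _]eq_sym.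
all: rewrite ?(negPf n12) ?(negPf n13) ?(negPf n14) ?(negPf n23) ?(negPf n24) ?(negPf n34) /=.
all: try ring.
Qed.
End Witness.

Section Complement.
Variables (R : realType) (k : nat) (d : 'I_k -> nat) (n : nat).
Local Notation T := (ptensor R d n).
Local Notation sym := (proj_sym R d n).
Implicit Types (S : {set 'I_k}) (x : T).

Lemma proj_sym_act g x : sym (sym_act R d [set: 'I_k] g x) = sym x.
Proof.
have inv1 (y : T) : sym_act R d [set: 'I_k] g (sym y) = sym y.
  by apply: memv_invariants; apply: orthoproj_mem.
rewrite -[RHS]inv1; apply: orthoproj_comm; first exact: sym_act_adj.
  by move=> u /memv_invariants uI; apply/memv_invariants => h; rewrite !uI.
by move=> u /memv_invariants uI; apply/memv_invariants => h; rewrite !uI.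
Qed.

Lemma sym_act_complement S g x :
  sym_act R d S g (sym_act R d (~: S) g x) = sym_act R d [set: 'I_k] g x.
Proof.
rewrite !sym_actE; apply/ffunP => X; rewrite !ffunE; congr (x _).
apply/ffunP => m; apply/ffunP => i; rewrite !ffunE !inE.
by case: (i \in S).
Qed.

Lemma proj_sym_flip S g x :
  sym (sym_act R d S g x) = sym (sym_act R d (~: S) g^-1 x).
Proof.
rewrite -[RHS](proj_sym_act g) -(sym_act_complement S); congr (sym (sym_act R d S g _)).
by rewrite -sym_actM mulVg sym_act1.
Qed.

Lemma proj_sym_isotypic S la x :
  x \in isotypic (@sym_act R k d n S) la ->
  sym x \in isotypic (@sym_act R k d n S) la.
Proof.
move=> xi; have -> : sym x = proj_side R d n S la (sym x).
  transitivity (sym (proj_side R d n S la x)); last exact: proj_sym_side.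
  by congr (fun_of_lfun _ _); apply/esym/orthoproj_id.
exact: orthoproj_mem.
Qed.

(** In the symmetric subspace a permutation of the legs [S] acts like the
    inverse permutation of the other legs, so that both sides of a bipartition
    have the same isotypic components there. *)
Lemma proj_sym_isotypic_complement S la x :
  x \in isotypic (@sym_act R k d n S) la ->
  sym x \in isotypic (@sym_act R k d n (~: S)) la.
Proof.
apply: isotypic_flip.
- exact: sym_act1.
- exact: sym_actM.
- exact: sym_actM.
- exact: sym_act_adj.
- move=> g h y; rewrite sym_act_disjoint //.
  by rewrite -finset.setI_eq0 finset.setIC finset.setICr.
- exact: proj_sym_flip.
exact: proj_sym_isotypic.
Qed.

(** The projectors are self-adjoint, so it is enough to pair with a vector that
    all of them fix. *)
Lemma proj_family_inner (theta : bipartition k -> R) (la : bipartition k -> seq nat)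
    (u f : T) :
    u \in invariants (@sym_act R k d n [set: 'I_k]) ->
    (forall b, theta b != 0 ->
       u \in isotypic (@sym_act R k d n (side b)) (la b)) ->
  inner u (proj_family d n theta la f) = inner u f.
Proof.
move=> uI uiso; rewrite /proj_family; elim: (index_enum _) => [|b r IH].
  by rewrite big_nil id_lfunE.
rewrite big_comp_cons; case: ifP => [thb|_]; last exact: IH.
have h x : inner u (proj_bip R d n b (la b) x) = inner u x.
  transitivity (inner (proj_side R d n (side b) (la b) u) (sym x)).
    by rewrite proj_bipE; apply/esym/orthoproj_adj.
  have -> : proj_side R d n (side b) (la b) u = u by apply/orthoproj_id/uiso.
  transitivity (inner (sym u) x); first exact/esym/orthoproj_adj.
  by congr (inner _ _); apply: orthoproj_id.
by rewrite h.
Qed.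

End Complement.

Lemma two_rows_partition n m : (0 < n)%N -> (m <= n - m)%N ->
  is_partition n (two_rows n m).
Proof.
move=> n0 mn; rewrite /is_partition /two_rows; case: eqVneq => [_|m0] /=.
  by rewrite inE addn0 eqxx !andbT; lia.
by rewrite !inE; lia.
Qed.

Section Sides.

Lemma leg_val i : (i < 4)%N -> nat_of_ord (inord i : 'I_4) = i.
Proof. exact: inordK. Qed.

Lemma legs_neqs : uniq [:: legA; legB; legC; legD].
Proof. by rewrite -(map_inj_uniq val_inj) /= !leg_val. Qed.

Lemma legs_cover (j : 'I_4) : j \in [:: legA; legB; legC; legD].
Proof.
rewrite !inE -!val_eqE /= !leg_val //.
by case: j => [[|[|[|[|]]]]].
Qed.

Lemma side_cut (b : bipartition 4) S :
  val b = cut S -> is_short_side S -> ~~ is_short_side (~: S) -> side b = S.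
Proof.
move=> bE sS sT; rewrite /side bE /cut.
case: pickP => [S' /andP[]|/(_ S)]; last by rewrite !inE eqxx sS.
by rewrite !inE => /orP[] /eqP -> //; rewrite (negPf sT).
Qed.

Lemma side1 (b : bipartition 4) j : val b = cut [set j] -> side b = [set j].
Proof.
move=> bE; apply: side_cut => //; rewrite /is_short_side.
  by rewrite cards1.
by rewrite cardsC1 card_ord.
Qed.

Lemma sideAB (b : bipartition 4) :
  val b = cut [set legA; legB] -> side b = [set legA; legB].
Proof.
have cAB : #|[set legA; legB]| = 2.
  by rewrite cards2 -val_eqE /= !leg_val.
move=> bE; apply: side_cut => //; rewrite /is_short_side.
  rewrite cAB /=; apply/existsP; exists legA; by rewrite !inE eqxx /= leg_val.
have -> : #|~: [set legA; legB]| = 2.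
  have := cardsC [set legA; legB]; rewrite cAB card_ord => e.
  by apply/eqP; rewrite -(eqn_add2l 2) e.
rewrite /=.
apply/existsP => -[j]; rewrite !inE negb_or => /andP[/andP[jA _] /eqP j0].
by case/eqP: jA; apply: val_inj; rewrite /= leg_val.
Qed.

Lemma compatible1 k j (S : {set 'I_k}) : compatible [set j] S /\ compatible S [set j].
Proof.
have h : compatible [set j] S.
  rewrite /compatible finset.sub1set disjoints1.
  by case: (j \in S); rewrite // orbT.
by split=> //; move: h; rewrite /compatible disjoint_sym orbCA orbA [X in X || _]orbC -orbA.
Qed.

Lemma side_cases (b : bipartition 4) :
    val b \in [:: cut [set legA; legB]; cut [set legA]; cut [set legB];
                  cut [set legC]; cut [set legD]] ->
  side b = [set legA; legB] \/ exists j, side b = [set j].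
Proof.
rewrite !inE => /orP[/eqP/sideAB|]; first by left.
by case/or4P => /eqP/side1 ->; right; [exists legA|exists legB|exists legC|exists legD].
Qed.

End Sides.

(** * The common value of the two functionals *)

Section Legs.

Lemma sum_legs (M : nmodType) (f : 'I_4 -> M) :
  \sum_j f j = f legA + f legB + f legC + f legD.
Proof.
rewrite (eq_bigl (mem [:: legA; legB; legC; legD])) => [|j]; last first.
  by apply/esym/legs_cover.
by rewrite -big_uniq ?legs_neqs //= !big_cons big_nil addr0 !addrA.
Qed.

Lemma legAB_neq : legA != legB.
Proof. by have := legs_neqs; rewrite /= !inE negb_or => /andP[/andP[]]. Qed.

Lemma sum_AB (M : nmodType) (f : 'I_4 -> M) :
  \sum_(j in [set legA; legB]) f j = f legA + f legB.
Proof. by rewrite big_setU1 ?inE ?legAB_neq //= big_set1. Qed.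

Lemma W4E (R : realType) (x : idx (fun _ : 'I_4 => 2%N)) :
  W4 R x = (exc [set: 'I_4] x == 1%N)%:R.
Proof.
rewrite /W4 sum_ffunE.
have entry j : pure (fun i : 'I_4 => if i == j then e2 R else e1 R) x =
    [forall i, (x i : nat) == (i == j)]%:R.
  rewrite ffunE; case: forallP => [h|h].
    apply: big1 => i _; have := h i; rewrite /e1 /e2.
    by case: (i == j) => /eqP xi; rewrite mxE -val_eqE /= xi.
  have [i xi] : exists i, (x i : nat) != (i == j).
    by apply/existsP; rewrite -negb_forall; apply/negP => /forallP.
  rewrite (bigD1 i) //= /e1 /e2; move: xi.
  by case: (i == j); rewrite mxE -val_eqE /= andbT => /negPf ->; rewrite mul0r.
under eq_bigr => j _ do rewrite entry.
have -> : exc [set: 'I_4] x = (\sum_j x j)%N by apply: eq_bigl => i; rewrite inE.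
have xle j : (x j <= 1)%N by rewrite -ltnS.
case: eqP => [e|e].
  have [j xj] : exists j, x j != 0 :> nat.
    apply/existsP; apply: contra_eqT e => /existsPn h.
    by rewrite big1 // => j _; apply/eqP/negPn/h.
  have xj1 : x j = 1%N :> nat by have := xle j; lia.
  have xi i : i != j -> x i = 0%N :> nat.
    move=> ij; move: e; rewrite (bigD1 j) //= (bigD1 i) //= xj1; lia.
  rewrite (bigD1 j) //= big1 ?addr0 => [|i ij].
    have -> // : [forall i, (x i : nat) == (i == j)].
    by apply/forallP => i; case: (eqVneq i j) => [->|/xi ->]; rewrite ?xj1.
  by case: forallP => // /(_ j); rewrite xj1 [j == i]eq_sym (negPf ij).
rewrite big1 => [//|j _]; case: forallP => // h; case: e.
rewrite (eq_bigr (fun i => nat_of_bool (i == j))) => [|i _]; last exact/eqP.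
by rewrite (bigD1 j) //= eqxx big1 // => i /negPf ->.
Qed.

End Legs.

Section Bounds.
Variable R : realType.
Variable theta : bipartition 4 -> R.
Hypothesis theta_ge0 : forall b, 0 <= theta b.
Hypothesis theta_supp : forall b : bipartition 4, theta b != 0 ->
       val b \in [:: cut [set legA; legB]; cut [set legA]; cut [set legB];
                     cut [set legC]; cut [set legD]].
Implicit Types (p q : 'I_4 -> R).

Definition simplex p := (forall j, 0 <= p j) /\ \sum_j p j = 1.

(** Its maximum over the simplex is the common value of the two functionals. *)
Definition excitation_entropy p : R :=
  \sum_b theta b * bin_entropy (\sum_(j in side b) p j).

Local Notation F := excitation_entropy.

Lemma simplex_side p (S : {set 'I_4}) : simplex p -> 0 <= \sum_(j in S) p j <= 1.
Proof.
move=> [p0 p1]; rewrite sumr_ge0 //= -p1 [leRHS](bigID (fun j => j \in S)) /=.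
by rewrite lerDl sumr_ge0.
Qed.

Lemma excitation_entropy_ge0 p : simplex p -> 0 <= F p.
Proof.
move=> ps; apply: sumr_ge0 => b _; rewrite mulr_ge0 //.
exact/bin_entropy_ge0/simplex_side.
Qed.

(** The point [q] is a convex combination of [p], with weight [t], and another
    point of the simplex, at which the nonnegative concave function [F] is
    nonnegative.  This replaces continuity of [F] at the boundary. *)
Lemma excitation_entropy_mix t p q : 0 < t < 1 -> simplex p -> simplex q ->
  (forall j, t * p j <= q j) -> t * F p <= F q.
Proof.
move=> /andP[t0 t1] ps qs tpq.
have t1' : 0 < 1 - t by rewrite subr_gt0.
pose r j := (q j - t * p j) / (1 - t).
have rs : simplex r.
  split=> [j|]; first by rewrite divr_ge0 ?subr_ge0 // ltW.
  rewrite -mulr_suml sumrB -mulr_sumr; case: ps => _ ->; case: qs => _ ->.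
  by rewrite mulr1 divff // gt_eqF.
rewrite mulr_sumr; apply: ler_sum => b _; rewrite mulrCA ler_wpM2l //.
have -> : \sum_(j in side b) q j =
    t * \sum_(j in side b) p j + (1 - t) * \sum_(j in side b) r j.
  rewrite !mulr_sumr -big_split; apply: eq_bigr => j _ /=.
  by rewrite /r [(1 - t) * _]mulrC divfK ?gt_eqF // addrC subrK.
apply: le_trans (bin_entropy_concave _ (simplex_side _ ps) (simplex_side _ rs)).
  by rewrite lerDl mulr_ge0 ?(ltW t1') // bin_entropy_ge0 // simplex_side.
by rewrite !ltW.
Qed.

Local Notation lower := (log_lower theta (W4 R)).
Local Notation upper := (log_upper theta (W4 R)).

(** An invertible rescaling cannot produce vanishing probabilities, so [p] is first
    mixed with the barycentre. *)
Lemma lower_ge p : simplex p -> ((F p)%:E <= lower)%E.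
Proof.
move=> ps; apply/lee_mul01Pr; first by rewrite lee_fin excitation_entropy_ge0.
move=> t t01; rewrite -EFinM.
have /andP[t0 t1] := t01.
pose q j := t * p j + (1 - t) / 4.
have q0 j : 0 < q j.
  have : 0 <= t * p j by apply: mulr_ge0; [exact: ltW | case: ps].
  by rewrite /q; lra.
have q1 : \sum_j q j = 1.
  rewrite big_split -mulr_sumr /=; case: ps => _ ->.
  by rewrite sumr_const card_ord -mulr_natr; field.
have [A uA HA] := orbit_entropy_diag q0 q1.
apply: (@le_trans _ _ (F q)%:E).
  rewrite lee_fin; apply: excitation_entropy_mix => // [|j].
    by split=> // j; apply: ltW.
  by rewrite lerDl divr_ge0 ?subr_ge0 // ltW.
apply: ereal_sup_ubound; exists A => //; congr EFin.
by apply: eq_bigr => b _; rewrite HA.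
Qed.

Lemma lower_le (y : \bar R) :
  (forall p, simplex p -> ((F p)%:E <= y)%E) -> (lower <= y)%E.
Proof.
move=> Fy; apply: ge_ereal_sup => _ [A uA <-].
have [p ps Hp] := orbit_entropy_le uA.
apply: le_trans (Fy p ps); rewrite lee_fin.
by apply: ler_sum => b _; rewrite ler_wpM2l.
Qed.

Definition freq n (w : 'I_4 -> nat) : 'I_4 -> R := fun j => (w j)%:R / n%:R.

Lemma freq_simplex n w : (0 < n)%N -> (\sum_j w j)%N = n -> simplex (freq n w).
Proof.
move=> n0 wn; split=> [j|]; first by rewrite divr_ge0 ?ler0n.
by rewrite -mulr_suml -natr_sum wn divff // pnatr_eq0 -lt0n.
Qed.

Lemma freq_side n w (S : {set 'I_4}) :
  \sum_(j in S) freq n w j = (\sum_(j in S) w j)%N%:R / n%:R.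
Proof. by rewrite -mulr_suml natr_sum. Qed.

Lemma theta_compatible b b' :
  theta b != 0 -> theta b' != 0 -> compatible (side b) (side b').
Proof.
move=> /theta_supp/side_cases [->|[j ->]] /theta_supp/side_cases [->|[j' ->]].
- by rewrite /compatible fintype.subxx.
- by case: (compatible1 j' [set legA; legB]).
- by case: (compatible1 j [set legA; legB]).
- by case: (compatible1 j [set j']).
Qed.

(** The excitation numbers of a word in the support satisfy [m <= w <= n - m] for
    each bipartition, which makes the entropy of [w / n] at least that of the
    partition with second row [m]. *)
Lemma upper_le (y : \bar R) :
  (forall p, simplex p -> ((F p)%:E <= y)%E) -> (upper <= y)%E.
Proof.
move=> Fy; apply: ge_ereal_sup => _ [n [la [n0 la_part nz ->]]].
have [w wn Hw] := proj_family_neq0_weights n0 (W4E R) theta_compatible la_part nz.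
apply: le_trans (Fy _ (freq_simplex n0 wn)); rewrite lee_fin big_mkcond.
apply: ler_sum => b _; case: eqVneq => [->|thb] /=; first by rewrite mul0r.
rewrite ler_wpM2l // freq_side; have [m [-> mn mw wm]] := Hw b thb.
have nR : 0 < n%:R :> R by rewrite ltr0n.
rewrite part_entropy_two_rows //; last by lia.
apply: bin_entropy_between; first by rewrite divr_ge0 ?ler0n.
rewrite ler_pM2r ?invr_gt0 // ler_nat mw /=.
have -> : 1 - m%:R / n%:R = (n - m)%N%:R / n%:R :> R.
  by rewrite natrB ?mulrBl ?divff ?gt_eqF //; lia.
by rewrite ler_pM2r ?invr_gt0 // ler_nat.
Qed.
End Bounds.

Section UpperBound.
Variable R : realType.
Local Notation d := (fun _ : 'I_4 => 2%N).
Local Notation AB := [set legA; legB].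
Local Notation act n S := (@sym_act R 4 d n S).

(** The lighter one of [AB] and [CD] takes the role of the block of two legs; the
    isotypic components of [CD] are transferred to [AB] in the symmetric
    subspace. *)
Lemma witness_exists N (w : 'I_4 -> nat) :
    (\sum_j w j = N + N)%N -> (forall j, (w j <= N)%N) ->
  exists v : ptensor R d (N + N),
    [/\ inner v (tpow (N + N) (W4 R)) != 0,
        forall j, v \in isotypic (act (N + N) [set j]) (two_rows (N + N) (w j)) &
        proj_sym R d (N + N) v \in isotypic (act (N + N) AB)
          (two_rows (N + N) (minn (w legA + w legB) (N + N - (w legA + w legB))))].
Proof.
rewrite sum_legs => w_sum wN.
have [wAB|wAB] := leqP (w legA + w legB) N.
  have w_sum' : (w legA + w legB + w legC + w legD = N + N)%N by [].
  exists (witness R N legA legB legC legD (w legA) (w legB) (w legD)); split.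
  - apply: (witness_tpow_neq0 legs_neqs legs_cover wAB (wN legC) (wN legD) w_sum').
    exact: W4E.
  - move=> j; have := legs_cover j; rewrite !inE => /or4P[] /eqP ->.
    + exact: (witness_isotypic1 R N _ _ _ legs_neqs).
    + exact: (witness_isotypic2 R _ legs_neqs wAB).
    + exact: (witness_isotypic3 R legs_neqs wAB (wN legC) (wN legD) w_sum').
    + exact: (witness_isotypic4 R legs_neqs wAB (wN legC) (wN legD) w_sum').
  apply: proj_sym_isotypic.
  have -> : minn (w legA + w legB) (N + N - (w legA + w legB)) = (w legA + w legB)%N.
    by lia.
  exact: (witness_isotypic12 R _ legs_neqs wAB).
have wCD : (w legC + w legD <= N)%N by lia.
have w_sum' : (w legC + w legD + w legA + w legB = N + N)%N by lia.
have uq : uniq [:: legC; legD; legA; legB].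
  by rewrite -(rot_uniq 2); apply: legs_neqs.
have cov j : j \in [:: legC; legD; legA; legB].
  by rewrite -(mem_rot 2); apply: legs_cover.
exists (witness R N legC legD legA legB (w legC) (w legD) (w legB)); split.
- apply: (witness_tpow_neq0 uq cov wCD (wN legA) (wN legB) w_sum').
  exact: W4E.
- move=> j; have := legs_cover j; rewrite !inE => /or4P[] /eqP ->.
  + exact: (witness_isotypic3 R uq wCD (wN legA) (wN legB) w_sum').
  + exact: (witness_isotypic4 R uq wCD (wN legA) (wN legB) w_sum').
  + exact: (witness_isotypic1 R N _ _ _ uq).
  + exact: (witness_isotypic2 R _ uq wCD).
have -> : AB = ~: [set legC; legD].
  have /= := uq; rewrite !inE !negb_or.
  move=> /andP[/and3P[_ CA CB] /andP[/andP[DA DB] _]].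
  apply/setP => j; have := cov j; rewrite !inE => /or4P[] /eqP ->;
    rewrite !eqxx ?orbT ?(negPf CA) ?(negPf CB) ?(negPf DA) ?(negPf DB) //;
    by rewrite ![_ == legC]eq_sym ![_ == legD]eq_sym ?(negPf CA) ?(negPf CB) ?(negPf DA) ?(negPf DB).
have -> : minn (w legA + w legB) (N + N - (w legA + w legB)) = (w legC + w legD)%N.
  by lia.
apply: proj_sym_isotypic_complement.
exact: (witness_isotypic12 R _ uq wCD).
Qed.

Variable theta : bipartition 4 -> R.
Hypothesis theta_ge0 : forall b, 0 <= theta b.
Hypothesis theta_supp : forall b : bipartition 4, theta b != 0 ->
       val b \in [:: cut [set legA; legB]; cut [set legA]; cut [set legB];
                     cut [set legC]; cut [set legD]].
Local Notation F := (excitation_entropy theta).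
Local Notation upper := (log_upper theta (W4 R)).

(** The length of the second row in the most balanced two-row partition that is
    compatible with [w] excitations. *)
Definition folded (n w : nat) := minn w (n - w).

Lemma folded_entropy n w w' : (0 < n)%N -> (w <= n)%N -> (w' <= n)%N ->
    (folded n w <= folded n w')%N ->
  bin_entropy (w%:R / n%:R) <= bin_entropy ((folded n w')%:R / n%:R) :> R.
Proof.
move=> n0 wn wn' ww'; have nR : 0 < n%:R :> R by rewrite ltr0n.
have subE a : (a <= n)%N -> (n - a)%N%:R / n%:R = 1 - a%:R / n%:R :> R.
  by move=> an; rewrite natrB // mulrBl divff // gt_eqF.
have -> : bin_entropy (w%:R / n%:R) = bin_entropy ((folded n w)%:R / n%:R) :> R.
  rewrite /folded /minn; case: ifP => // _.
  by rewrite subE // bin_entropyC.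
apply: bin_entropy_between; first by rewrite divr_ge0 ?ler0n.
rewrite -subE; last by rewrite /folded in ww' *; lia.
by rewrite !ler_pM2r ?invr_gt0 // !ler_nat; rewrite /folded in ww' *; lia.
Qed.

(** The excitations of a leg in excess of [N] can be moved to a leg of the other
    pair without making any of the five counts more unbalanced. *)
Lemma balance_counts N a b c e : (a + b + c + e = N + N)%N ->
  exists a' b' c' e', [/\ (a' + b' + c' + e' = N + N)%N,
    [/\ (a' <= N)%N, (b' <= N)%N, (c' <= N)%N & (e' <= N)%N],
    [/\ (folded (N + N) a <= a')%N, (folded (N + N) b <= b')%N,
        (folded (N + N) c <= c')%N & (folded (N + N) e <= e')%N] &
    (folded (N + N) (a + b) <= folded (N + N) (a' + b'))%N].
Proof.
rewrite /folded => s.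
have [hA|hA] := ltnP N a.
  by exists N, b, (c + (a - N))%N, e; split; [|split|split|]; lia.
have [hB|hB] := ltnP N b.
  by exists a, N, (c + (b - N))%N, e; split; [|split|split|]; lia.
have [hC|hC] := ltnP N c.
  by exists (a + (c - N))%N, b, N, e; split; [|split|split|]; lia.
have [hE|hE] := ltnP N e.
  by exists (a + (e - N))%N, b, c, N; split; [|split|split|]; lia.
by exists a, b, c, e; split; [|split|split|]; lia.
Qed.

(** After balancing the counts, a vector that all the projectors fix and that has
    nonzero inner product with the power of the W tensor shows that the projected
    power does not vanish. *)
Lemma upper_ge_freq N (w : 'I_4 -> nat) : (0 < N)%N -> (\sum_j w j = N + N)%N ->
  ((F (freq R (N + N) w))%:E <= upper)%E.
Proof.
move=> N0 w_sum; set n := (N + N)%N.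
have n0 : (0 < n)%N by rewrite addn_gt0 N0.
have := w_sum; rewrite sum_legs => /balance_counts.
move=> [a [b [c [e [s [aN bN cN eN] [wa wb wc we] wab]]]]].
pose w' j := if j == legA then a else if j == legB then b
  else if j == legC then c else e.
have [wA wB wC wD] : [/\ w' legA = a, w' legB = b, w' legC = c & w' legD = e].
  by rewrite /w' -!val_eqE /= !leg_val.
have w'N j : (w' j <= N)%N by rewrite /w'; do ?case: ifP.
have w'_sum : (\sum_j w' j = n)%N by rewrite sum_legs wA wB wC wD.
have [v [v_psi v1 vAB]] := witness_exists w'_sum w'N.
pose wS (b : bipartition 4) := (\sum_(j in side b) w j)%N.
pose wS' (b : bipartition 4) := (\sum_(j in side b) w' j)%N.
pose la b := two_rows n (folded n (wS' b)).
have le_n (x : 'I_4 -> nat) (S : {set 'I_4}) : (\sum_j x j = n)%N -> (\sum_(j in S) x j <= n)%N.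
  by move=> <-; rewrite [leqRHS](bigID (fun j => j \in S)) /= leq_addr.
have fold1 j : folded n (w' j) = w' j by have := w'N j; rewrite /folded /n; lia.
have fold_le b0 : theta b0 != 0 -> (folded n (wS b0) <= folded n (wS' b0))%N.
  move=> /theta_supp/side_cases [sAB|[j sj]].
    by rewrite /wS /wS' sAB !sum_AB wA wB.
  rewrite /wS /wS' sj !big_set1 fold1.
  by have := legs_cover j; rewrite !inE => /or4P[] /eqP ->; rewrite ?wA ?wB ?wC ?wD.
pose u := proj_sym R d n v.
have uI : u \in invariants (act n [set: 'I_4]) by apply: orthoproj_mem.
have u_iso b0 : theta b0 != 0 -> u \in isotypic (act n (side b0)) (la b0).
  move=> /theta_supp/side_cases [sAB|[j sj]]; rewrite /la /wS'.
    by rewrite sAB sum_AB.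
  by rewrite sj big_set1 fold1; apply/proj_sym_isotypic/v1.
have nz : proj_family d n theta la (tpow n (W4 R)) != 0.
  apply: contraNneq v_psi => E.
  have := proj_family_inner (tpow n (W4 R)) uI u_iso; rewrite E inner0r.
  rewrite /u [inner (proj_sym _ _ _ _) _]orthoproj_adj orthoproj_id ?tpow_invariant //.
  by move=> <-.
apply: (@le_trans _ _
  (\sum_(b0 | theta b0 != 0) theta b0 * part_entropy R n (la b0))%:E); last first.
  apply: ereal_sup_ubound; exists n, la; split=> // b0 _.
  by apply: two_rows_partition => //; rewrite /folded; lia.
rewrite lee_fin [leRHS]big_mkcond; apply: ler_sum => b0 _.
case: eqVneq => [->|thb] /=; first by rewrite mul0r.
rewrite ler_wpM2l // freq_side part_entropy_two_rows //; last first.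
  by have : (wS' b0 <= n)%N := le_n _ _ w'_sum; rewrite /folded; lia.
apply: folded_entropy => //; [exact: le_n | exact: le_n | exact: fold_le].
Qed.

(** All coordinates but the first are rounded up; what this adds is compensated by
    the factor [t] once the denominator is large. *)
Lemma freq_approx (p : 'I_4 -> R) t : simplex p -> 0 < t < 1 ->
  exists N w, [/\ (0 < N)%N, (\sum_j w j = N + N)%N &
    forall j, t * p j <= freq R (N + N) w j].
Proof.
move=> [p0 p1] /andP[t0 t1].
pose N := (Num.truncn (3 / (1 - t))).+1; pose n := (N + N)%N.
have t1' : 0 < 1 - t by rewrite subr_gt0.
have nR : 0 < n%:R :> R by rewrite ltr0n addn_gt0.
(* Rounding three coordinates up costs at most 3. *)
have n_big : 3 <= n%:R * (1 - t).
  have : 3 / (1 - t) < N%:R.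
    by have /andP[] := truncn_itv (ltW (divr_gt0 (ltr0n R 3 : 0 < 3) t1')).
  rewrite ltr_pdivrMr // /n natrD; nra.
pose w0 j := (Num.truncn (n%:R * (t * p j))).+1.
have np0 j : 0 <= n%:R * (t * p j).
  by apply: mulr_ge0; [exact: ltW | apply: mulr_ge0; [exact: ltW | exact: p0]].
have w0_ge j : n%:R * (t * p j) <= (w0 j)%:R.
  by have /andP[_ /ltW] := truncn_itv (np0 j).
have w0_le j : (w0 j)%:R <= n%:R * (t * p j) + 1.
  by have /andP[h _] := truncn_itv (np0 j); rewrite /w0 -natr1 lerD2r.
have p_sum : p legA + p legB + p legC + p legD = 1 by rewrite -sum_legs.
have rest_le : (w0 legB)%:R + (w0 legC)%:R + (w0 legD)%:R <=
    n%:R - n%:R * (t * p legA) :> R.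
  have := w0_le legB; have := w0_le legC; have := w0_le legD.
  have -> : p legB = 1 - p legA - p legC - p legD by lra.
  rewrite !mulrBr; lra.
pose r := (w0 legB + w0 legC + w0 legD)%N.
have rn : (r <= n)%N.
  by rewrite -(ler_nat R) /r natrD natrD; have := np0 legA; lra.
exists N, (fun j => if j == legA then (n - r)%N else w0 j); split=> //.
  have /= := legs_neqs; rewrite !inE !negb_or => /andP[/and3P[AB' AC AD] _].
  rewrite sum_legs eqxx ![_ == legA]eq_sym (negPf AB') (negPf AC) (negPf AD).
  suff : (n - r + w0 legB + w0 legC + w0 legD = n)%N by [].
  by rewrite -!addnA (addnA (w0 legB)) subnK.
move=> j; rewrite /freq ler_pdivlMr // mulrC; case: eqP => [->|_] //.
have rE : r%:R = (w0 legB)%:R + (w0 legC)%:R + (w0 legD)%:R :> R.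
  by rewrite /r !natrD.
by rewrite natrB // rE -/n; lra.
Qed.

Lemma upper_ge (p : 'I_4 -> R) : simplex p -> ((F p)%:E <= upper)%E.
Proof.
move=> ps; apply/lee_mul01Pr; first by rewrite lee_fin excitation_entropy_ge0.
move=> t t01; rewrite -EFinM.
have [N [w [N0 w_sum hw]]] := freq_approx ps t01.
apply: le_trans (upper_ge_freq N0 w_sum); rewrite lee_fin.
apply: excitation_entropy_mix => //.
by apply: freq_simplex => //; rewrite addn_gt0 N0.
Qed.

End UpperBound.

Theorem theorem4p17 (R : realType) (theta : bipartition 4 -> R)
    (theta_distr : is_distribution theta)
    (theta_supp : forall b : bipartition 4, theta b != 0 ->
       val b \in [:: cut [set legA; legB]; cut [set legA]; cut [set legB];
                     cut [set legC]; cut [set legD]]) :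
  log_upper theta (W4 R) = log_lower theta (W4 R).
Proof.
have [theta_ge0 _] := theta_distr.
apply/eqP; rewrite eq_le; apply/andP; split.
  by apply: upper_le => // p ps; apply: lower_ge.
by apply: lower_le => // p ps; apply: upper_ge.
Qed.
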